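(* Let $f=f_0+f_b$ be the penalized placement objective, let $L$ and $\mu$ be the associated constants, and let $(z_k)_{k\ge0}$ be generated by the stochastic subgradient iteration (RBSM), all as defined in the context. Suppose $\mu>L$ and the stepsizes satisfy $\alpha_k>0$, $\lim_{k\to\infty}\alpha_k=0$, $\sum_{k=0}^\infty\alpha_k=\infty$ and $\sum_{k=0}^\infty\alpha_k^2<\infty$. Let $S=\{z\in\mathbb{R}^{2n}:0\in\partial f(z)\}$, where $\partial f(z)$ is the Clarke subdifferential. Then $\operatorname{dist}(z_k,S)\to0$ almost surely.
   Context: Placement data: $V=\{v_1,\dots,v_n\}$ is a finite set of cells; cell $v_i$ is a rectangle of width $w_i>0$ and height $h_i>0$ with center $(x_i,y_i)\in\mathbb{R}^2$. $E=\{e_1,\dots,e_m\}$ is a finite set of nets, each net being a nonempty subset of $V$. The placement region is the rectangle with lower left corner $(0,0)$ and upper right corner $(W,H)$. Write $z=(x_1,y_1,\dots,x_n,y_n)\in\mathbb{R}^{2n}$. $\operatorname{ReLU}(t)=\max(0,t)$. $\operatorname{HPWL}(z)=\sum_{e\in E}\bigl(\max_{v_i,v_j\in e}|x_i-x_j|+\max_{v_i,v_j\in e}|y_i-y_j|\bigr)$. For $r,t>0$, $\varphi_{r,t}(x,y)=0$ if $|x|\ge r$ or $|y|\ge t$; $\varphi_{r,t}(x,y)=1-|x|/r$ if $|y|/t\le|x|/r<1$; $\varphi_{r,t}(x,y)=1-|y|/t$ if $|x|/r<|y|/t<1$. With fixed penalty parameters $\gamma_i>0$, $\gamma_{ij}>0$,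 and $w_{ij}=\frac{w_i+w_j}{2}$, $h_{ij}=\frac{h_i+h_j}{2}$, put $$f_0(z)=\operatorname{HPWL}(z)+\sum_{i<j}\gamma_{ij}\,\varphi_{w_{ij},h_{ij}}(x_i-x_j,y_i-y_j),$$ $$f_b(z)=\sum_{i=1}^n\gamma_i\Bigl[\operatorname{ReLU}(\tfrac{w_i}{2}-x_i)+\operatorname{ReLU}(x_i-W+\tfrac{w_i}{2})+\operatorname{ReLU}(\tfrac{h_i}{2}-y_i)+\operatorname{ReLU}(y_i-H+\tfrac{h_i}{2})\Bigr],$$ and $f=f_0+f_b$. For a locally Lipschitz $F$, $\partial F(z)$ denotes the Clarke subdifferential: the closed convex hull of all limits $\lim_j\nabla F(z_j)$ with $z_j\to z$, $F$ differentiable at $z_j$. $\|\cdot\|$ is the Euclidean norm and $\operatorname{dist}$ the Euclidean distance to a set. Constants: $L>0$ and $B>0$ are constants such that $\|v\|\le L$ and $\|s\|\le B$ for all $z\in\mathbb{R}^{2n}$, $v\in\partial f_0(z)$, $s\in\partial f_b(z)$; $\mu=\min_i\gamma_i$. Iteration (RBSM): the initial point $z_0$ is (possibly randomly) chosen in a bounded range, and $$z_{k+1}=z_k-\alpha_k\hat g_k,\qquad \hat g_k=g_k+\xi_k=v_k+s_k+\xi_k,\qquad v_k\in\partial f_0(z_k),\ s_k\in\partial f_b(z_k),$$ where $g_k=v_k+s_k$ is the (possibly random, mini-batch) subgradient estimator, $\alpha_k$ are deterministic stepsizes, and $\xi_k=\epsilon_k\|g_k\|\eta_k$ with $\epsilon_k=0.2/k^3$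 for $k\ge1$ ($\epsilon_0\ge0$ a fixed constant) and $\eta_k\sim\mathcal{N}(0,I)$ independent of $z_0,g_0,\eta_0,\dots,g_{k-1},\eta_{k-1},g_k$. Let $\mathcal{F}_k$ be the $\sigma$-algebra generated by $z_0,g_0,\eta_0,\dots,g_{k-1},\eta_{k-1}$, so that $z_k$ is $\mathcal{F}_k$-measurable. It is assumed that the estimator is conditionally unbiased, $\mathbb{E}[g_k\mid\mathcal{F}_k]\in\partial f(z_k)$ almost surely, and that $\mathbb{E}[\xi_k\mid\mathcal{F}_k]=0$ and $\mathbb{E}[\|\xi_k\|^2\mid\mathcal{F}_k]\le\sigma^2$ almost surely for a constant $\sigma$ independent of $k$. *)

(* Defs.v *)
From HB Require Import structures.
From mathcomp Require Import all_boot all_order all_algebra.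
From mathcomp Require Import all_classical all_reals all_analysis.
Import Order.TTheory GRing.Theory Num.Theory.
Import numFieldNormedType.Exports.

Set Implicit Arguments.
Unset Strict Implicit.
Unset Printing Implicit Defensive.

Local Open Scope classical_set_scope.
Local Open Scope ring_scope.

(* The library norm on ['rV_d] is the sup norm; its topology is the usual one,
   but lengths and distances have to be Euclidean. *)
Definition enorm (R : realType) (d : nat) (x : 'rV[R]_d) : R :=
  Num.sqrt (\sum_(i < d) x ord0 i ^+ 2).

(* Extended-real valued, so that the distance to the empty set is [+oo]. *)
Definition edist_to (R : realType) (d : nat) (x : 'rV[R]_d)
    (A : set 'rV[R]_d) : \bar R :=
  ereal_inf [set (enorm (x - y))%:E | y in A].

(* Equal to the gradient only where [F] is differentiable. *)
Definition grad (R : realType) (d : nat) (F : 'rV[R]_d -> R) (x : 'rV[R]_d) :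
    'rV[R]_d :=
  \row_(i < d) 'D_('e_i) F x.

Definition limiting_gradients (R : realType) (d : nat) (F : 'rV[R]_d -> R)
    (x : 'rV[R]_d) : set 'rV[R]_d :=
  [set g | exists u : nat -> 'rV[R]_d,
    [/\ forall j, differentiable F (u j),
        u j @[j --> \oo] --> x &
        grad F (u j) @[j --> \oo] --> g]].

Definition closed_convex_hull (R : realType) (d : nat) (A : set 'rV[R]_d) :
    set 'rV[R]_d :=
  smallest [set C | closed C /\ @convex_set R 'rV[R]_d C] A.

Definition clarke (R : realType) (d : nat) (F : 'rV[R]_d -> R)
    (x : 'rV[R]_d) : set 'rV[R]_d :=
  closed_convex_hull (limiting_gradients F x).

Record placement (R : realType) (n : nat) := Placement {
  cell_w : 'I_n -> R;
  cell_h : 'I_n -> R;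
  region_w : R;
  region_h : R;
  nets : {set {set 'I_n}};
  bnd_pen : 'I_n -> R;
  ovl_pen : 'I_n -> 'I_n -> R;
  cell_w_gt0 : forall i, 0 < cell_w i;
  cell_h_gt0 : forall i, 0 < cell_h i;
  region_w_gt0 : 0 < region_w;
  region_h_gt0 : 0 < region_h;
  nets_neq0 : finset.set0 \notin nets;
  bnd_pen_gt0 : forall i, 0 < bnd_pen i;
  (* only the pairs [i < j] occur in the objective *)
  ovl_pen_gt0 : forall i j : 'I_n, (i < j)%N -> 0 < ovl_pen i j
}.

Definition relu (R : realType) (t : R) : R := Num.max 0 t.

(* [vec_mx] is row-major, so [z = (x_1, y_1, ..., x_n, y_n)] in R^(2n) becomes
   the n x 2 matrix whose i-th row is the centre of the i-th cell. *)
Definition xc (R : realType) (n : nat) (z : 'rV[R]_(n * 2)) (i : 'I_n) : R :=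
  vec_mx z i ord0.
Definition yc (R : realType) (n : nat) (z : 'rV[R]_(n * 2)) (i : 'I_n) : R :=
  vec_mx z i ord_max.

(* The maxima are over nonempty sets of nonnegative reals, so the default value
   0 is harmless. *)
Definition hpwl (R : realType) (n : nat) (D : placement R n)
    (z : 'rV[R]_(n * 2)) : R :=
  \sum_(e in nets D)
    (\big[Num.max/0]_(i in e) \big[Num.max/0]_(j in e) `|xc z i - xc z j| +
     \big[Num.max/0]_(i in e) \big[Num.max/0]_(j in e) `|yc z i - yc z j|).

Definition phi (R : realType) (r t x y : R) : R :=
  if (r <= `|x|) || (t <= `|y|) then 0
  else if `|y| / t <= `|x| / r then 1 - `|x| / r
  else 1 - `|y| / t.

Definition f0 (R : realType) (n : nat) (D : placement R n)
    (z : 'rV[R]_(n * 2)) : R :=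
  hpwl D z +
  \sum_(i < n) \sum_(j < n | (i < j)%N)
    ovl_pen D i j * phi ((cell_w D i + cell_w D j) / 2)
                        ((cell_h D i + cell_h D j) / 2)
                        (xc z i - xc z j) (yc z i - yc z j).

Definition fb (R : realType) (n : nat) (D : placement R n)
    (z : 'rV[R]_(n * 2)) : R :=
  \sum_(i < n) bnd_pen D i *
    (relu (cell_w D i / 2 - xc z i) +
     relu (xc z i - region_w D + cell_w D i / 2) +
     relu (cell_h D i / 2 - yc z i) +
     relu (yc z i - region_h D + cell_h D i / 2)).

Definition objective (R : realType) (n : nat) (D : placement R n)
    (z : 'rV[R]_(n * 2)) : R := f0 D z + fb D z.

Definition min_bnd_pen (R : realType) (n : nat) (D : placement R n.+1) : R :=
  \big[Num.min/bnd_pen D ord0]_(i < n.+1) bnd_pen D i.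

Definition random_vector (R : realType) (disp : measure_display)
    (Omega : measurableType disp) (d : nat) (X : Omega -> 'rV[R]_d) : Prop :=
  forall i, measurable_fun [set: Omega] (fun w => X w ord0 i).

Definition sigma_of (R : realType) (Omega : Type) (d : nat)
    (XS : set (Omega -> 'rV[R]_d)) : set (set Omega) :=
  <<s [set A | exists X i (B : set R),
         [/\ XS X, measurable B & A = (fun w => X w ord0 i) @^-1` B]] >>.

(* The law of [X] is N(0, I): it agrees on boxes with the product of d copies
   of the one-dimensional standard normal law. *)
Definition standard_gaussian (R : realType) (disp : measure_display)
    (Omega : measurableType disp) (P : probability Omega R) (d : nat)
    (X : Omega -> 'rV[R]_d) : Prop :=
  random_vector X /\
  forall B : 'I_d -> set R, (forall i, measurable (B i)) ->
    P [set w | forall i, B i (X w ord0 i)] =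
    (\prod_(i < d) normal_prob 0 1 (B i))%E.

Definition independent_sigma (R : realType) (disp : measure_display)
    (Omega : measurableType disp) (P : probability Omega R)
    (F G : set (set Omega)) : Prop :=
  forall A B, F A -> G B -> P (A `&` B) = (P A * P B)%E.

(* [Y] is a version of E[X | F]. *)
Definition is_cond_exp (R : realType) (disp : measure_display)
    (Omega : measurableType disp) (P : probability Omega R)
    (F : set (set Omega)) (X Y : Omega -> R) : Prop :=
  [/\ P.-integrable [set: Omega] (EFin \o X),
      P.-integrable [set: Omega] (EFin \o Y),
      forall B : set R, measurable B -> F (Y @^-1` B) &
      forall A, F A ->
        (\int[P]_(w in A) (Y w)%:E = \int[P]_(w in A) (X w)%:E)%E].

Definition is_vcond_exp (R : realType) (disp : measure_display)
    (Omega : measurableType disp) (P : probability Omega R) (d : nat)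
    (F : set (set Omega)) (X Y : Omega -> 'rV[R]_d) : Prop :=
  forall i, is_cond_exp P F (fun w => X w ord0 i) (fun w => Y w ord0 i).

(* The variables z_0, g_0, eta_0, ..., g_(k-1), eta_(k-1). *)
Definition history (R : realType) (Omega : Type) (d : nat)
    (z g eta : nat -> Omega -> 'rV[R]_d) (k : nat) :
    set (Omega -> 'rV[R]_d) :=
  [set X | X = z 0%N \/ exists2 j, (j < k)%N & X = g j \/ X = eta j].

(* Main.v *)
(* The objective is piecewise linear: it is locally conic around every point and,
   on each cell of a finite partition, every Clarke subgradient v at z satisfies
   f z' - f z = <v, z' - z> for z' in the cell of z.  Local conicity gives
   clarke f y `<=` clarke f z for y near z, and the cell identity shows that f
   takes finitely many critical values.

   Noise: g_k - E[g_k | F_k] and xi_k are martingale differences bounded in L2,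
   so their alpha_k-weighted sums converge almost surely.  From here on the
   argument is pathwise.  Since mu > L, the drift outside a large box points
   inwards, which keeps the iterates bounded.

   Rescaling time by the step sizes, the iterates converge along any free
   ultrafilter to a Lipschitz curve Z whose right difference quotients at t lie
   in -clarke f (Z t).  Except at countably many t the curve returns to the cell
   of Z t immediately after t, and then the cell identity gives a strict decrease
   of f; hence f (Z t) < f (Z 0) for small t > 0 if Z 0 is not critical.  A limit
   point that is not critical would make f (z_k) cross a noncritical level upwards
   infinitely often; limiting the upcrossing segments contradicts this descent. *)

Require Import Defs.
From HB Require Import structures.
From mathcomp Require Import all_boot all_order all_algebra.
From mathcomp Require Import all_classical all_reals all_analysis.
From mathcomp Require Import measurable_realfun ring lra.
Import Order.TTheory GRing.Theory Num.Theory.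
Import numFieldNormedType.Exports.
Set Implicit Arguments.
Unset Strict Implicit.
Unset Printing Implicit Defensive.
Local Open Scope classical_set_scope.
Local Open Scope ring_scope.

(** * Piecewise linear functions *)

Section PiecewiseLinear.
Variables (R : realType) (V : normedModType R).
Implicit Types (f g : V -> R) (z d h : V) (c t r : R).

Definition lipschitz_fun f :=
  exists2 K : R, 0 < K & forall x y, `|f x - f y| <= K * `|x - y|.

Definition conic_at f z := exists2 r, 0 < r &
  forall h t, `|h| < r -> 0 <= t <= 1 -> f (z + t *: h) = f z + t * (f (z + h) - f z).

(** The slope [c] is shared by all base points near [z], not only by [z] itself; this later fixes
    the product of every nearby gradient with [d]. *)
Definition affine_along f z d c := exists2 r, 0 < r &
  forall h t, `|h| < r -> 0 <= t <= r -> f (z + h + t *: d) = f (z + h) + t * c.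

(** A form of piecewise linearity without polyhedra: the cells need not be convex or closed, and the
    three clauses together are stable under sums, multiples and [relu]. *)
Definition pwl f := [/\ lipschitz_fun f, forall z, conic_at f z &
  exists (T : finType) (cell : V -> T), forall z z', cell z = cell z' ->
    affine_along f z (z' - z) (f z' - f z)].

Lemma pwl_affine f (l : V -> R) (b : R) : lipschitz_fun f ->
  (forall x y t, l (x + t *: y) = l x + t * l y) ->
  (forall x, f x = l x + b) -> pwl f.
Proof.
move=> fL ll fE; have l0 : l 0 = 0.
  by have := ll 0 0 1; rewrite scaler0 addr0 mul1r; lra.
have lD x y : l (x + y) = l x + l y by rewrite -(scale1r y) ll scale1r mul1r.
split => //.
  by move=> z; exists 1 => // h t _ _; rewrite !fE ll lD; ring.
exists unit, (fun=> tt) => z z' _; exists 1 => // h t _ _; rewrite !fE ll lD.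
have -> : l (z' - z) = l z' - l z by rewrite -scaleN1r ll; ring.
ring.
Qed.

Lemma pwl_cst c : pwl (fun=> c).
Proof.
apply: (@pwl_affine _ (fun=> 0) c); last by move=> x; rewrite add0r.
  by exists 1 => // x y; rewrite subrr normr0 mul1r.
by move=> *; ring.
Qed.

Lemma pwlD f g : pwl f -> pwl g -> pwl (fun x => f x + g x).
Proof.
move=> [[K K0 fK] fc [T [c fcell]]] [[K' K'0 gK] gc [T' [c' gcell]]]; split.
- exists (K + K'); first exact: addr_gt0.
  move=> x y; rewrite opprD addrACA mulrDl (le_trans (ler_normD _ _))//.
  by rewrite lerD.
- move=> z; have [r r0 fr] := fc z; have [s s0 gs] := gc z.
  exists (Num.min r s); first by rewrite lt_min r0.
  by move=> h t; rewrite lt_min => /andP[hr hs] t01; rewrite fr// gs//; ring.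
- exists (T * T')%type, (fun x => (c x, c' x)) => z z' [cz c'z].
  have [r r0 fr] := fcell _ _ cz; have [s s0 gs] := gcell _ _ c'z.
  exists (Num.min r s); first by rewrite lt_min r0.
  move=> h t; rewrite lt_min => /andP[hr hs] /andP[t0].
  rewrite le_min => /andP[tr ts]; rewrite fr ?t0// gs ?t0//; ring.
Qed.

Lemma pwlZ a f : pwl f -> pwl (fun x => a * f x).
Proof.
move=> [[K K0 fK] fc [T [c fcell]]]; split.
- exists ((`|a| + 1) * K); first by rewrite mulr_gt0// ltr_wpDl.
  move=> x y; rewrite -mulrBr normrM -mulrA ler_pM// ?lerDl//.
- move=> z; have [r r0 fr] := fc z; exists r => // h t hr t01.
  by rewrite fr//; ring.
- exists T, c => z z' cz; have [r r0 fr] := fcell _ _ cz; exists r => // h t hr tr.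
  by rewrite fr//; ring.
Qed.

Lemma pwlN f : pwl f -> pwl (fun x => - f x).
Proof.
move=> /(pwlZ (-1)); congr pwl; apply/funext => x; exact: mulN1r.
Qed.

Lemma pwlB f g : pwl f -> pwl g -> pwl (fun x => f x - g x).
Proof. by move=> pf pg; apply: pwlD => //; exact: pwlN. Qed.

Lemma pwl_sum (I : Type) (s : seq I) (P : pred I) (F : I -> V -> R) :
  (forall i, pwl (F i)) -> pwl (fun x => \sum_(i <- s | P i) F i x).
Proof.
move=> FP; elim: s => [|i s IH].
  by under eq_fun do rewrite big_nil; exact: pwl_cst.
under eq_fun do rewrite big_cons.
by case: (P i) => //; exact: pwlD.
Qed.

Lemma lipschitz_gt0 f z : lipschitz_fun f -> 0 < f z ->
  exists2 r, 0 < r & forall h, `|h| < r -> 0 < f (z + h).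
Proof.
move=> [K K0 fK] fz; exists (f z / K); first exact: divr_gt0.
move=> h; rewrite ltr_pdivlMr// => hK.
have := fK (z + h) z; rewrite addrAC subrr add0r ler_norml => /andP[] ? _.
lra.
Qed.

Lemma lipschitz_lt0 f z : lipschitz_fun f -> f z < 0 ->
  exists2 r, 0 < r & forall h, `|h| < r -> f (z + h) < 0.
Proof.
move=> [K K0 fK] fz; have fL : lipschitz_fun (fun x => - f x).
  by exists K => // x y; rewrite -opprD normrN.
have [|r r0 fr] := @lipschitz_gt0 _ z fL; first by rewrite oppr_gt0.
by exists r => // h /fr; rewrite oppr_gt0.
Qed.

Lemma lipschitz_sg f z : lipschitz_fun f -> f z != 0 ->
  exists2 r, 0 < r & forall h, `|h| < r -> Num.sg (f (z + h)) = Num.sg (f z).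
Proof.
move=> fL; rewrite neq_lt => /orP[fz|fz].
  by have [r r0 fr] := lipschitz_lt0 fL fz; exists r => // h /fr /ltr0_sg ->; rewrite ltr0_sg.
by have [r r0 fr] := lipschitz_gt0 fL fz; exists r => // h /fr /gtr0_sg ->; rewrite gtr0_sg.
Qed.

Lemma relu_sg (x y : R) : Num.sg x = Num.sg y -> y != 0 ->
  relu x = (Num.sg y == 1)%:R * x.
Proof.
rewrite /relu => + y0; rewrite maxEle; case: (ltgtP 0 y) y0 => [y0|y0|<-];
  rewrite ?eqxx// => _.
  by rewrite (gtr0_sg y0) => /eqP; rewrite sgr_cp0 => x0; rewrite (ltW x0) eqxx mul1r.
rewrite (ltr0_sg y0) => /eqP; rewrite sgr_cp0 => x0; rewrite leNgt x0/=.
have -> : (-1 == 1 :> R) = false by apply/eqP => ?; lra.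
by rewrite mul0r.
Qed.

Lemma relu_homo (t x : R) : 0 <= t -> relu (t * x) = t * relu x.
Proof. by move=> t0; rewrite /relu maxr_pMr// mulr0. Qed.

Lemma relu_lip (x y : R) : `|relu x - relu y| <= `|x - y|.
Proof.
rewrite /relu !maxEle; case: (leP 0 x) => x0; case: (leP 0 y) => y0 //.
- rewrite subr0 ger0_norm// ler_normr; apply/orP; left; lra.
- rewrite sub0r normrN ger0_norm// ler_normr; apply/orP; right; lra.
- by rewrite subrr normr0.
Qed.

(** Where [g z] is nonzero its sign is locally constant and [relu] acts as a factor 0 or 1. Where
    [g z = 0], conicity survives because [relu] is positively homogeneous. *)
Lemma pwl_relu g : pwl g -> pwl (fun x => relu (g x)).
Proof.
move=> [gL gc [T [c gcell]]]; split.
- have [K K0 gK] := gL; exists K => // x y.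
  exact: le_trans (relu_lip _ _) _.
- move=> z; have [r r0 gr] := gc z; have [gz|gz] := eqVneq (g z) 0.
    exists r => // h t hr /[dup] t01 /andP[t0 _].
    by rewrite gr// gz !subr0 !add0r relu_homo// /relu maxxx subr0 add0r.
  have [s s0 gs] := lipschitz_sg gL gz.
  exists (Num.min r s); first by rewrite lt_min r0.
  move=> h t; rewrite lt_min => /andP[hr hs] /[dup] t01 /andP[t0 t1].
  have ths : `|t *: h| < s.
    by rewrite normrZ ger0_norm// (le_lt_trans _ hs)// ler_piMl.
  by rewrite !(relu_sg _ gz) ?gs// gr//; ring.
(* Cells are refined by the sign of [g], so a cell through a zero of [g] lies in its zero set and
   the slope of [g] between its points is 0. *)
- exists (T * (bool * bool))%type, (fun x => (c x, (0 < g x, g x < 0))).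
  move=> z z' [cz gp gn]; have [r r0 gr] := gcell _ _ cz.
  have sgE : Num.sg (g z') = Num.sg (g z).
    by move: gp gn; case: (sgrP (g z)); case: (sgrP (g z')) => //; lra.
  have [gz|gz] := eqVneq (g z) 0.
    have gz' : g z' = 0.
      by move: sgE; rewrite gz sgr0 => /eqP; rewrite sgr_eq0 => /eqP.
    exists r => // h t hr t01; rewrite gr// gz gz' subrr mulr0 addr0.
    by rewrite subrr mulr0 addr0.
  have [s s0 gs] := lipschitz_sg gL gz.
  (* This radius keeps both [h] and [h + t *: (z' - z)] in the ball of radius [s] where the sign of
     [g] is constant. *)
  pose q := s / (1 + `|z' - z|); have q0 : 0 < q by rewrite divr_gt0// ltr_pwDl.
  exists (Num.min r q); first by rewrite lt_min r0.
  move=> h t; rewrite lt_min => /andP[hr hs] /andP[t0].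
  rewrite le_min => /andP[tr tq].
  have hts : `|h + t *: (z' - z)| < s.
    rewrite (le_lt_trans (ler_normD _ _))// normrZ ger0_norm//.
    rewrite (@lt_le_trans _ _ (q + q * `|z' - z|))//.
      by rewrite ltr_leD// ler_wpM2r.
    by rewrite -{1}[q]mulr1 -mulrDr /q divfK// lt0r_neq0// ltr_pwDl.
  have hs' : `|h| < s.
    by rewrite (lt_le_trans hs)// ler_pdivrMr ?ltr_pwDl// ler_peMr ?lerDl// ltW.
  rewrite -addrA !(relu_sg _ gz) ?gs//.
  by rewrite addrA gr ?t0//; ring.
Qed.

Lemma maxE_relu (a b : R) : Num.max a b = a + relu (b - a).
Proof. by rewrite /relu !maxEle subr_ge0; case: ifP => _; ring. Qed.

Lemma normE_relu (a : R) : `|a| = relu a + relu (- a).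
Proof.
rewrite /relu !maxEle oppr_ge0; case: (ltgtP 0 a) => a0.
- by rewrite gtr0_norm// addr0.
- by rewrite ltr0_norm// add0r.
- by rewrite -a0 normr0 oppr0 addr0.
Qed.

Lemma pwl_max f g : pwl f -> pwl g -> pwl (fun x => Num.max (f x) (g x)).
Proof.
move=> pf pg; under eq_fun do rewrite maxE_relu.
by apply: pwlD => //; apply: pwl_relu; exact: pwlB.
Qed.

Lemma pwl_norm f : pwl f -> pwl (fun x => `|f x|).
Proof.
move=> pf; under eq_fun do rewrite normE_relu.
by apply: pwlD; apply: pwl_relu => //; exact: pwlN.
Qed.

Lemma pwl_bigmax (I : Type) (s : seq I) (P : pred I) (F : I -> V -> R) :
  (forall i, pwl (F i)) -> pwl (fun x => \big[Num.max/0]_(i <- s | P i) F i x).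
Proof.
move=> FP; elim: s => [|i s IH].
  by under eq_fun do rewrite big_nil; exact: pwl_cst.
under eq_fun do rewrite big_cons.
by case: (P i) => //; exact: pwl_max.
Qed.

End PiecewiseLinear.

(** * Clarke subdifferentials of piecewise linear functions *)

Lemma diff_epsP (R : realType) (V W : normedModType R) (f : V -> W)
    (df : {linear V -> W}) (x : V) : continuous df ->
  (forall e : R, 0 < e ->
    \forall k \near 0, `|f (k + x) - f x - df k| <= e * `|k|) ->
  differentiable f x /\ 'd f x = df :> (V -> W).
Proof.
move=> cdf fe; have E : f \o shift x = cst (f x) + df +o_ 0 id.
  apply/eqaddoP => e /fe; apply: filterS => k /=; rewrite !fctE/= opprD addrA.
  exact.
by have dE := diff_unique cdf E; split=> //; apply/diff_locallyP; rewrite dE.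
Qed.

Lemma diff_eps (R : realType) (V W : normedModType R) (f : V -> W) (x : V)
  (e : R) : differentiable f x -> 0 < e ->
  \forall k \near 0, `|f (k + x) - f x - 'd f x k| <= e * `|k|.
Proof.
move=> /diff_locally /eqaddoP fe /fe; apply: filterS => k /=.
by rewrite !fctE/= opprD addrA.
Qed.

Section Clarke.
Variables (R : realType) (d : nat).
Local Notation V := 'rV[R]_d.
Implicit Types (F : V -> R) (x y z u v w h : V).

Definition dotv v w : R := \sum_(i < d) v ord0 i * w ord0 i.

Lemma dotvDl v v' w : dotv (v + v') w = dotv v w + dotv v' w.
Proof. by rewrite -big_split/=; apply: eq_bigr => i _; rewrite mxE mulrDl. Qed.

Lemma dotvZl c v w : dotv (c *: v) w = c * dotv v w.
Proof. by rewrite mulr_sumr; apply: eq_bigr => i _; rewrite mxE mulrA. Qed.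

Lemma dotvC v w : dotv v w = dotv w v.
Proof. by apply: eq_bigr => i _; rewrite mulrC. Qed.

Lemma dotvZr c v w : dotv v (c *: w) = c * dotv v w.
Proof. by rewrite dotvC dotvZl dotvC. Qed.

Lemma dot0v w : dotv 0 w = 0.
Proof. by rewrite -(scale0r w) dotvZl mul0r. Qed.

Lemma dotv_continuous w : continuous (dotv^~ w).
Proof.
move=> v; apply: (@cvg_big R _ +%R 0 predT (@add_continuous R) _ (nbhs v)) => i _.
 apply: cvgM; last exact: cvg_cst.
exact: coord_continuous.
Qed.

Lemma coord_le_norm v i : `|v ord0 i| <= `|v|.
Proof.
rewrite -[leRHS]/(mx_norm v) mx_normrE.
by apply: (le_bigmax _ (fun ij => `|v ij.1 ij.2|) (ord0, i)).
Qed.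

Lemma clarke_sub F z (C : set V) : closed C ->
  (forall v w (t : R), C v -> C w -> 0 <= t <= 1 -> C (t *: v + (1 - t) *: w)) ->
  limiting_gradients F z `<=` C -> clarke F z `<=` C.
Proof.
move=> Ccl Ccv; apply: smallest_sub; split => // v w t.
rewrite !inE => Cv Cw; apply: Ccv => //.
by apply/andP; split.
Qed.

Lemma clarke_closed F z : closed (clarke F z).
Proof. by apply: closed_bigI => C [[]]. Qed.

Lemma clarke_convex F z v w (t : R) : clarke F z v -> clarke F z w ->
  0 <= t <= 1 -> clarke F z (t *: v + (1 - t) *: w).
Proof.
move=> Fv Fw /andP[t0 t1] C CC.
have [[_ cvC] _] := CC.
have := cvC v w (Itv01 t0 t1); rewrite !inE; apply; [exact: Fv|exact: Fw].
Qed.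

Lemma dotv_grad F u w : differentiable F u -> dotv (grad F u) w = 'D_w F u.
Proof.
move=> dF; rewrite deriveE// [in RHS](row_sum_delta w) linear_sum.
by apply: eq_bigr => i _; rewrite linearZ /= mxE deriveE// mulrC.
Qed.

(** At a point of differentiability near [z] the derivative along [w] is exactly [c], because
    [affine_along] covers nearby base points. The vectors with product [c] form a closed convex set,
    which therefore contains the whole subdifferential. *)
Lemma clarke_affine_along F z w c : affine_along F z w c ->
  clarke F z `<=` [set v | dotv v w = c].
Proof.
move=> [r r0 Fr]; apply: clarke_sub.
- by have /continuous_closedP := @dotv_continuous w => /(_ [set c]); apply; exact: closed_eq.
- by move=> v v' t /= vc v'c _; rewrite dotvDl !dotvZl vc v'c; ring.
move=> v [u [uF uz gv]] /=.
have : dotv (grad F (u j)) w @[j --> \oo] --> dotv v w.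
  by apply: (@cvg_comp _ _ _ _ (dotv^~ w) _ _ _ gv); exact: dotv_continuous.
move=> /cvg_unique; apply; first exact: norm_hausdorff.
apply: cvg_near_cst; near=> j.
have uj : `|u j - z| < r.
  by near: j; move/cvgrPdist_lt : uz => /(_ _ r0); apply: filterS => j; rewrite distrC.
(* [F] is known to be affine only for [t >= 0], so the derivative is computed as a limit from the
   right. *)
rewrite dotv_grad// /derive cvg_at_rightE; last exact: diff_derivable.
apply/cvg_lim => //; apply: cvg_near_cst; near=> t.
have t0 : 0 < t by near: t; exact: nbhs_right_gt.
have := Fr (u j - z) t uj; rewrite [z + _]addrC subrK => E.
rewrite /= [t *: w + _]addrC E.
  by rewrite addrAC subrr add0r /GRing.scale/= mulKf ?gt_eqF.
by rewrite (ltW t0)/=; near: t; exact: nbhs_right_le.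
Unshelve. all: by end_near. Qed.

Lemma clarke_bound F z (K : R) : 0 <= K -> (forall x y, `|F x - F y| <= K * `|x - y|) ->
  clarke F z `<=` [set v | forall i, `|v ord0 i| <= K].
Proof.
move=> K0 FK; apply: clarke_sub.
- rewrite [X in closed X](_ : _ =
      \bigcap_i ((fun v : V => `|v ord0 i|) @^-1` [set x | x <= K])); last first.
    by apply/seteqP; split => v vK i; [move=> _; exact: vK|exact: vK].
  apply: closed_bigI => i _; have : continuous (fun v : V => `|v ord0 i|).
    by move=> v; apply: (cvg_norm (@coord_continuous _ _ _ ord0 i v)).
  by move=> /continuous_closedP/(_ [set x | x <= K]); apply; exact: closed_le.
- move=> v w t /= vK wK /andP[t0 t1] i.
  rewrite !mxE (le_trans (ler_normD _ _))// !normrM (ger0_norm t0).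
  rewrite (@ger0_norm _ (1 - t)) ?subr_ge0// (_ : K = t * K + (1 - t) * K); last by ring.
  by rewrite lerD// ler_wpM2l// subr_ge0.
move=> v [u [uF uz gv]] i /=.
have : `|grad F (u j) ord0 i| @[j --> \oo] --> `|v ord0 i|.
  apply: cvg_norm; apply: (@cvg_comp _ _ _ _ (fun v : V => v ord0 i) _ _ _ gv).
  exact: coord_continuous.
apply: (closed_cvg _ (@closed_le _ K)).
near=> j => /=.
rewrite mxE /derive.
have := @diff_derivable _ _ _ F (u j) 'e_i (uF j) => dF.
have dF' := @cvg_norm _ _ _ _ _ _ _ dF.
have {}dF' := dF' (@dnbhs_filter _ _).
move: dF'. apply: (closed_cvg _ (@closed_le _ K)).
near=> t => /=.
have t0 : t != 0 by near: t; exact: nbhs_dnbhs_neq.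
rewrite normrZ normfV ler_pdivrMl ?normr_gt0// mulrC.
rewrite (le_trans (FK _ _))// addrK normrZ ler_wpM2l//.
rewrite ler_piMr// -[leLHS]/(mx_norm _) mx_normrE; apply: bigmax_le => // -[a b] _.
by rewrite mxE; case: (_ && _); rewrite ?normr1 ?normr0.
Unshelve. all: by end_near. Qed.

(** Conicity makes [F] near [z + t *: h] a copy of [F] near [z + h], scaled by [t] in both argument
    and increment; the two scalings cancel in the gradient. *)
Lemma diff_rescale F z h (t r : R) : `|h| < r -> 0 < t -> t <= 1 ->
  (forall h t, `|h| < r -> 0 <= t <= 1 -> F (z + t *: h) = F z + t * (F (z + h) - F z)) ->
  differentiable F (z + h) ->
  differentiable F (z + t *: h) /\ grad F (z + t *: h) = grad F (z + h).
Proof.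
move=> hr t0 t1 Fr dF.
have cF : continuous ('d F (z + h)) by exact: diff_continuous.
have [|dF' dE] := @diff_epsP _ _ _ F ('d F (z + h)) (z + t *: h) cF; last first.
  split; first exact: dF'.
  apply/rowP => i; rewrite /grad 2!mxE.
  rewrite (deriveE _ dF').
  rewrite (deriveE _ dF).
  exact: (congr1 (fun f : V -> R => f 'e_i) dE).
move=> e e0; have /nbhs_ballP[/= s s0 sF] := diff_eps dF e0.
(* After division by [t], a perturbation shorter than [q] meets the differentiability estimate at
   [z + h] and keeps [h + k'] in the conic ball. *)
pose q := t * Num.min s (r - `|h|).
have q0 : 0 < q by rewrite mulr_gt0// lt_min s0 subr_gt0.
apply/nbhs_ballP; exists q => //= k; rewrite -ball_normE/= sub0r normrN => kq.
pose k' := t^-1 *: k.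
have kE : k = t *: k' by rewrite scalerA divff ?scale1r// gt_eqF.
move: kq; rewrite kE normrZ gtr0_norm// /q ltr_pM2l// lt_min => /andP[k's k'r].
have := sF k'; rewrite -ball_normE/= sub0r normrN => /(_ k's) H.
have -> : t *: k' + (z + t *: h) = z + t *: (h + k').
  by rewrite scalerDr addrCA [_ *: h + _]addrC.
rewrite !Fr ?(ltW t0)//; last first.
  by rewrite (le_lt_trans (ler_normD _ _))//; lra.
have -> : 'd F (z + h) (t *: k') = t * 'd F (z + h) k' by rewrite linearZ.
rewrite mulrCA.
rewrite (_ : z + (h + k') = k' + (z + h)); last by rewrite addrA addrC.
rewrite [X in `|X|](_ : _ = t * (F (k' + (z + h)) - F (z + h) - 'd F (z + h) k')).
  by rewrite normrM gtr0_norm// ler_pM2l.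
ring.
Qed.

(** Near [z], gradients are constant along rays from [z]. A sequence approaching [y] can thus be
    contracted towards [z] without changing its gradients, so limiting gradients at [y] are limiting
    gradients at [z]. *)
Lemma clarke_conic F z : conic_at F z -> exists2 r, 0 < r &
  forall y, `|y - z| < r -> clarke F y `<=` clarke F z.
Proof.
move=> [r r0 Fr]; exists r => // y yr.
suff yz : limiting_gradients F y `<=` limiting_gradients F z.
  apply: clarke_sub; first exact: clarke_closed.
    by move=> *; exact: clarke_convex.
  by apply: (subset_trans yz); exact: sub_gen_smallest.
move=> g [u [uF uy gg]].
have [N _ uN] : \forall j \near \oo, `|u j - z| < r.
  have : `|u j - z| @[j --> \oo] --> `|y - z|.
    by apply: cvg_norm; apply: cvgB => //; exact: cvg_cst.
  move=> /cvgr_lt; exact.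
pose t (j : nat) : R := j.+1%:R^-1.
have t01 j : 0 < t j <= 1.
  by rewrite invr_gt0 ltr0n/= invf_le1 ?ler1n// ltr0n.
pose w j := z + t j *: (u (N + j)%N - z).
have H j : differentiable F (w j) /\ grad F (w j) = grad F (u (N + j)%N).
  have /andP[t0 t1] := t01 j.
  have := @diff_rescale F z (u (N + j)%N - z) (t j) r.
  rewrite subrKC; apply => //; apply: uN; exact: leq_addr.
exists w; split.
- by move=> j; have [] := H j.
- rewrite -[X in _ --> X]addr0; apply: cvgD; first exact: cvg_cst.
  apply/cvgrPdist_lt => e e0; near=> j.
  rewrite sub0r normrN normrZ gtr0_norm; last by case/andP: (t01 j).
  rewrite (@le_lt_trans _ _ (t j * r))//.
    rewrite ler_wpM2l//; first by case/andP: (t01 j) => /ltW.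
    by apply/ltW/uN; exact: leq_addr.
  rewrite -ltr_pdivlMr//; near: j.
  by apply: near_infty_natSinv_lt (PosNum (divr_gt0 e0 r0)).
- under eq_fun do rewrite (H _).2.
  by have := gg; rewrite -(cvg_shiftn N); under eq_fun do rewrite addnC.
Unshelve. all: by end_near. Qed.

End Clarke.

(** * The placement objective *)

Section Placement.
Variables (R : realType) (n : nat) (D : placement R n).
Local Notation V := 'rV[R]_(n * 2).
Implicit Types (z v s : V) (i : 'I_n) (b : 'I_2).

Lemma pwl_coord (d : nat) (j : 'I_d) : pwl (fun z : 'rV[R]_d => z ord0 j).
Proof.
refine (@pwl_affine R _ _ (fun z : 'rV[R]_d => z ord0 j) 0 _ _ _).
- exists 1 => // x y; rewrite mul1r (le_trans _ (coord_le_norm _ j))//.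
  by rewrite !mxE.
- by move=> x y t; rewrite !mxE.
- by move=> x; rewrite addr0.
Qed.

Definition crd z i b : R := vec_mx z i b.

Lemma crdE z i b : crd z i b = z ord0 (mxvec_index i b).
Proof. by rewrite /crd mxE. Qed.

Lemma pwl_crd i b : pwl (fun z : V => crd z i b).
Proof. by under eq_fun do rewrite crdE; exact: pwl_coord. Qed.

(** The graph of [phi] is a pyramid of height 1 over the rectangle of half-sides [r] and [t]; in
    this form it falls under the closure rules of [pwl]. *)
Lemma phiE (r t x y : R) : 0 < r -> 0 < t ->
  phi r t x y = relu (1 - Num.max (r^-1 * `|x|) (t^-1 * `|y|)).
Proof.
move=> r0 t0; rewrite /phi /relu.
rewrite -[r <= _]/(r <= `|x|) -(mul1r r) -ler_pdivlMr// -[t <= _]/(t <= `|y|).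
rewrite -(mul1r t) -(@ler_pdivlMr _ t)// !mul1r ![_^-1 * _]mulrC.
move: (`|x| / r) (`|y| / t) => {}x {}y.
rewrite !maxEle; case: (leP 1 x) => x1 /=; case: (leP 1 y) => y1 /=;
  case: (leP x y) => xy; case: ifPn => ?; try (by []); try lra.
all: by case: ifPn => ?; lra.
Qed.

Lemma pwl_f0 : pwl (f0 D).
Proof.
apply: pwlD.
  apply: pwl_sum => e.
  by apply: pwlD; apply: pwl_bigmax => i; apply: pwl_bigmax => j;
    apply/pwl_norm/pwlB; exact: pwl_crd.
apply: pwl_sum => i; apply: pwl_sum => j.
have cw k : 0 < cell_w D k := cell_w_gt0 D k.
have ch k : 0 < cell_h D k := cell_h_gt0 D k.
under eq_fun do rewrite phiE ?divr_gt0 ?addr_gt0//.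
apply/pwlZ/pwl_relu/pwlB; first exact: pwl_cst.
by apply: pwl_max; apply/pwlZ/pwl_norm/pwlB; exact: pwl_crd.
Qed.

Definition side_len i b : R := if b == ord0 then cell_w D i else cell_h D i.
Definition region_len b : R := if b == ord0 then region_w D else region_h D.
Definition side_pen i b (t : R) : R :=
  relu (side_len i b / 2 - t) + relu (t - region_len b + side_len i b / 2).

Lemma fbE z : fb D z =
  \sum_(i < n) \sum_(b < 2) bnd_pen D i * side_pen i b (crd z i b).
Proof.
apply: eq_bigr => i _; rewrite big_ord_recl big_ord1 -mulrDr; congr (_ * _).
rewrite /side_pen /side_len /region_len /=.
have -> : lift ord0 ord0 = ord_max :> 'I_2 by apply/val_inj.
by rewrite !addrA.
Qed.

Lemma pwl_fb : pwl (fb D).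
Proof.
rewrite (funext fbE).
apply: pwl_sum => i; apply: pwl_sum => b; apply: pwlZ.
have zP := pwl_crd i b.
by apply: pwlD; apply: pwl_relu;
  [apply: pwlB => //; exact: pwl_cst|apply: pwlD; [apply: pwlB => //|]; exact: pwl_cst].
Qed.

Lemma pwl_objective : pwl (objective D).
Proof. exact: pwlD pwl_f0 pwl_fb. Qed.

Lemma fb_affine_along z i b (c r : R) : 0 < r ->
  (forall x t, `|x| < r -> 0 <= t <= r ->
     side_pen i b (crd z i b + x + t) = side_pen i b (crd z i b + x) + t * c) ->
  affine_along (fb D) z 'e_(mxvec_index i b) (bnd_pen D i * c).
Proof.
move=> r0 Hr; exists r => //.
suff H (h : V) (t : R) : `|h| < r -> 0 <= t <= r -> fb D (z + h + t *: 'e_(mxvec_index i b)) =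
    fb D (z + h) + t * (bnd_pen D i * c) by move=> h t; exact: H.
move=> hr tr; rewrite !fbE.
have E j b' : crd (z + h + t *: 'e_(mxvec_index i b)) j b' =
    crd z j b' + crd h j b' + t * ((j == i) && (b' == b))%:R.
  by rewrite /crd !linearD linearZ/= vec_mx_delta 2!mxE [in X in _ + X]mxE [delta_mx _ _ _ _]mxE.
have Eh j b' : crd (z + h) j b' = crd z j b' + crd h j b' by rewrite /crd !mxE.
rewrite !pair_big/= (bigD1 (i, b))//= [in RHS](bigD1 (i, b))//=. rewrite E !Eh !eqxx mulr1.
rewrite Hr//; last first.
  by rewrite crdE; exact: le_lt_trans (coord_le_norm _ _) hr.
rewrite mulrDr mulrCA addrAC; congr (_ + _ + _).
by apply: eq_bigr => -[j b'] /=; rewrite xpair_eqE E Eh => /negbTE ->; rewrite mulr0 addr0.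
Qed.

(** Beyond this bound, on either side of 0, exactly one of the two hinges of [side_pen] is active,
    with room for the radius [side_len i b / 4]. *)
Definition outer_len i b := side_len i b + region_len b.

Lemma side_len_gt0 i b : 0 < side_len i b.
Proof. by rewrite /side_len; case: ifP => _; [exact: cell_w_gt0|exact: cell_h_gt0]. Qed.

Lemma region_len_gt0 b : 0 < region_len b.
Proof. by rewrite /region_len; case: ifP => _; [exact: region_w_gt0|exact: region_h_gt0]. Qed.

(** Here [side_pen] has slope 1, so [fb] is affine along the basis vector and [clarke_affine_along]
    determines this coordinate of every subgradient. *)
Lemma clarke_fb_gt z s i b : outer_len i b < crd z i b -> clarke (fb D) z s ->
  crd s i b = bnd_pen D i.
Proof.
move=> zM /(@clarke_affine_along R (n * 2) (fb D) z ('e_(mxvec_index i b)) (bnd_pen D i * 1)).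
rewrite mulr1 /= => <-; last first.
  have := side_len_gt0 i b; have := region_len_gt0 b; move: zM.
  rewrite /outer_len => zM rg sg; rewrite -[X in affine_along _ _ _ X]mulr1.
  apply: (@fb_affine_along _ _ _ _ (side_len i b / 4)) => //; first lra.
  move=> x t; rewrite ltr_norml => /andP[x1 x2] /andP[t1 t2].
  by rewrite /side_pen /relu !maxEle; do ![case: ifPn => ?]; lra.
rewrite crdE /dotv (bigD1 (mxvec_index i b))//= !mxE !eqxx mulr1 big1 ?addr0// => j ji.
by rewrite mxE (negbTE ji) mulr0.
Qed.

Lemma clarke_fb_lt z s i b : crd z i b < - outer_len i b -> clarke (fb D) z s ->
  crd s i b = - bnd_pen D i.
Proof.
move=> zM /(@clarke_affine_along R (n * 2) (fb D) z ('e_(mxvec_index i b)) (bnd_pen D i * -1)).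
rewrite mulrN1 /= => <-; last first.
  have := side_len_gt0 i b; have := region_len_gt0 b; move: zM.
  rewrite /outer_len => zM rg sg; rewrite -mulrN1.
  apply: (@fb_affine_along _ _ _ _ (side_len i b / 4)) => //; first lra.
  move=> x t; rewrite ltr_norml => /andP[x1 x2] /andP[t1 t2].
  by rewrite /side_pen /relu !maxEle; do ![case: ifPn => ?]; lra.
rewrite crdE /dotv (bigD1 (mxvec_index i b))//= !mxE !eqxx mulr1 big1 ?addr0// => j ji.
by rewrite mxE (negbTE ji) mulr0.
Qed.

End Placement.

Lemma coord_le_enorm (R : realType) (d : nat) (v : 'rV[R]_d) (i : 'I_d) :
  `|v ord0 i| <= enorm v.
Proof.
rewrite -sqrtr_sqr ler_sqrt; last by apply: sumr_ge0 => j _; exact: sqr_ge0.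
by rewrite (bigD1 i)//= lerDl; apply: sumr_ge0 => j _; exact: sqr_ge0.
Qed.

Lemma min_bnd_pen_le (R : realType) (n : nat) (D : placement R n.+1) i :
  min_bnd_pen D <= bnd_pen D i.
Proof. exact: bigmin_le_cond. Qed.

(** * Descent along limiting trajectories *)

(** An interval contained in a countable set would have Lebesgue measure 0. *)
Lemma exists_between_notin (R : realType) (a b : R) (E : set R) :
  countable E -> a < b -> exists y, [/\ a < y, y < b & ~ E y].
Proof.
move=> cE ab; apply: contrapT => noy.
have sub : `]a, b[ `<=` E.
  move=> y /=; rewrite in_itv/= => /andP[ay yb].
  by apply: contrapT => Ey; apply: noy; exists y.
have /countable_lebesgue_measure0 : countable `]a, b[.
  exact: sub_countable (subset_card_le sub) cE.
rewrite lebesgue_measure_itv/= lte_fin ab => /eqP.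
by rewrite -EFinB eqe subr_eq0 gt_eqF.
Qed.

(* If [g 0 < g b], pick [y] between them outside [g @` E] and look at the last
   time [t] with [g t <= y]: there [g t = y], so [t] is not exceptional. *)
Lemma lipschitz_nonincreasing (R : realType) (g : R -> R) (b C : R) (E : set R) :
  0 <= b ->
  (forall s t, 0 <= s <= b -> 0 <= t <= b -> `|g s - g t| <= C * `|s - t|) ->
  countable E ->
  (forall t, 0 <= t < b -> ~ E t -> exists2 s, t < s <= b & g s <= g t) ->
  g b <= g 0.
Proof.
move=> b0 gC cE gE; rewrite leNgt; apply/negP => gb.
have [y [y0 yb gEy]] := exists_between_notin (sub_countable (card_image_le g E) cE) gb.
pose A := [set x | 0 <= x <= b /\ g x <= y].
have A0 : A 0 by rewrite /A/= lexx b0 ltW.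
have Aub : has_ubound A by exists b => x [/andP[]].
have Asup : has_sup A by split; [exists 0|].
pose t := sup A.
have t0 : 0 <= t by exact: ub_le_sup.
have tb : t <= b by apply: ge_sup; [exists 0|move=> x [/andP[]]].
have C0 : 0 <= C.
  have := gC 0 b; rewrite lexx b0 lexx/= => /(_ isT isT).
  have : 0 < `|g 0 - g b| by rewrite normr_gt0 subr_eq0 lt_eqF.
  rewrite sub0r normrN => gp /(lt_le_trans gp).
  by rewrite leNgt; apply: contraL => C0; rewrite -leNgt nmulr_rle0.
have gty : g t <= y.
  apply/ler_addgt0Pr => e e0.
  have [x [/andP[x0 xb] gx] tx] := sup_adherent (divr_gt0 e0 (ltr_wpDl C0 ltr01)) Asup.
  have xt : x <= t by apply: ub_le_sup => //; split=> //; rewrite x0.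
  have := gC t x; rewrite t0 tb x0 xb => /(_ isT isT).
  rewrite [`|t - x|]ger0_norm ?subr_ge0// => /(le_trans (ler_norm _)) H.
  have H2 : C * (t - x) <= (C + 1) * (e / (C + 1)).
    by apply: ler_pM => //; rewrite ?subr_ge0 ?lerDl//; rewrite -/t in tx; lra.
  rewrite [_ * (e / _)]mulrC divfK ?gt_eqF// in H2; last exact: ltr_wpDl.
  lra.
have tltb : t < b.
  by rewrite lt_neqAle tb andbT; apply: contraTneq gty => ->; rewrite -ltNge.
have gyt : y <= g t.
  apply/ler_addgt0Pr => e e0.
  pose x := Num.min b (t + e / (C + 1)).
  have C1 : 0 < C + 1 by exact: ltr_wpDl.
  have tx : t < x by rewrite lt_min tltb ltrDl divr_gt0.
  have xb : x <= b by rewrite ge_min lexx.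
  have x0 : 0 <= x by rewrite (le_trans t0)// ltW.
  have gxy : y < g x.
    rewrite ltNge; apply/negP => gx.
    have : x <= t by apply: ub_le_sup => //; split=> //; rewrite x0.
    by rewrite leNgt tx.
  have := gC x t; rewrite x0 xb t0 tb => /(_ isT isT).
  rewrite [`|x - t|]ger0_norm ?subr_ge0 ?(ltW tx)// => /(le_trans (ler_norm _)) H.
  have H2 : C * (x - t) <= (C + 1) * (e / (C + 1)).
    by apply: ler_pM => //; rewrite ?subr_ge0 ?lerDl ?(ltW tx)// lerBlDl ge_min lexx orbT.
  rewrite [_ * (e / _)]mulrC divfK ?gt_eqF// in H2.
  lra.
have gt : g t = y by apply/le_anti; rewrite gty.
have tE : ~ E t by move=> Et; apply: gEy; exists t.
have [|s /andP[ts sb] gs] := gE t _ tE; first by rewrite t0.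
have : s <= t.
  apply: ub_le_sup => //; split; last by rewrite -gt.
  by rewrite sb andbT (le_trans t0)// ltW.
by rewrite leNgt ts.
Qed.

(* Distinct right-isolated points of the same cell are separated by rationals. *)
Lemma countable_right_isolated (R : realType) (T : finType) (c : R -> T) :
  countable [set t | exists2 h, 0 < h & forall s, t < s < t + h -> c s != c t].
Proof.
set E := [set t | _].
have /choice [q qE] : forall t, exists q : rat, E t -> t < ratr q /\
    forall s, t < s -> s <= ratr q -> c s != c t.
  move=> t; have [[h h0 hE]|nE] := pselect (E t); last by exists 0.
  have [|q] := @rat_in_itvoo R t (t + h); first by rewrite ltrDl.
  rewrite in_itv/= => /andP[tq qh].
  exists q => _; split=> // s ts sq; apply: hE; rewrite ts.
  exact: le_lt_trans sq qh.
apply/countable_injP; exists (fun t => choice.pickle (c t, q t)).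
move=> s t; rewrite !inE => /qE[sq sE] /qE[tq tE] /(pcan_inj choice.pickleK)[cst qst].
have [st|ts|//] := ltgtP s t.
- by have := sE t st; rewrite qst (ltW tq) cst eqxx => /(_ isT).
- by have := tE s ts; rewrite -qst (ltW sq) cst eqxx => /(_ isT).
Qed.

Section Descent.
Variables (R : realType) (d : nat).
Local Notation V := 'rV[R]_d.
Implicit Types (x y z v w : V).

Lemma sqr_norm_le_dotv v : `|v| ^+ 2 <= dotv v v.
Proof.
have vv0 : 0 <= dotv v v by apply: sumr_ge0 => i _; rewrite -expr2 sqr_ge0.
rewrite -[leRHS]sqr_sqrtr// ler_sqr ?nnegrE ?sqrtr_ge0//.
rewrite -[leLHS]/(mx_norm v) mx_normrE; apply: bigmax_le; first exact: sqrtr_ge0.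
move=> [i j] _ /=; rewrite -sqrtr_sqr ler_sqrt//.
rewrite /dotv (bigD1 j)//= (ord1 i) expr2 lerDl.
by apply: sumr_ge0 => k _; rewrite -expr2 sqr_ge0.
Qed.

Definition cell_gradient (T : finType) (cell : V -> T) (f : V -> R) (G : V -> set V) :=
  forall z z' v, cell z = cell z' -> G z v -> f z' - f z = dotv v (z' - z).

Definition locally_contained (G : V -> set V) :=
  forall z, exists2 r : R, 0 < r & forall y, `|y - z| < r -> G y `<=` G z.

(** Just after a time that is not right-isolated, the curve meets its cell again, and the cell
    identity gives a drop of [u - s] times the squared length of an element of [G (Z 0)]. The
    exceptional times are countable, so [lipschitz_nonincreasing] extends these drops to the whole
    interval. *)
Lemma strict_descent (T : finType) (cell : V -> T) (f : V -> R) (G : V -> set V)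
    (K : R) (Z : R -> V) :
  lipschitz_fun f -> cell_gradient cell f G -> locally_contained G ->
  closed (G (Z 0)) -> 0 < K ->
  (forall s t, 0 <= s -> 0 <= t -> `|Z s - Z t| <= K * `|s - t|) ->
  (forall t, 0 <= t -> exists2 h, 0 < h &
     forall s, t < s < t + h -> G (Z t) ((s - t)^-1 *: (Z t - Z s))) ->
  ~ G (Z 0) 0 ->
  exists2 b, 0 < b & forall t, 0 < t <= b -> f (Z t) < f (Z 0).
Proof.
move=> [C C0 fC] Gf GU Gcl K0 ZK ZG G0.
(* As [G (Z 0)] is closed and misses 0, its elements are bounded away from 0. *)
have [rho rho0 Grho] : exists2 rho : R, 0 < rho & forall v, G (Z 0) v -> rho <= `|v|.
  have : nbhs (0 : V) (~` G (Z 0)) by apply: open_nbhs_nbhs; split=> //; exact: closed_openC.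
  move=> /nbhs_ballP[e /= e0 eG]; exists e => // v Gv.
  rewrite leNgt; apply/negP => ve; apply: (eG v) => //.
  by rewrite -ball_normE/= sub0r normrN.
have [r r0 rG] := GU (Z 0).
(* Up to time [b] the curve moves at most [r / 2], so [G (Z t)] stays inside [G (Z 0)]. *)
pose b := r / (K + K).
have KK : 0 < K + K by rewrite addr_gt0.
have b0 : 0 < b by rewrite divr_gt0.
have GZ t : 0 <= t <= b -> G (Z t) `<=` G (Z 0).
  move=> /andP[t0 tb]; apply: rG; rewrite (le_lt_trans (ZK _ _ _ _))// subr0 ger0_norm//.
  have : K * t <= K * b by rewrite ler_pM2l.
  rewrite /b; have -> : K * (r / (K + K)) = r / 2 by field; lra.
  lra.
exists b => // t /andP[t0 tb].
(* Half of the guaranteed decay rate [rho ^+ 2] goes into [g]: from [g t <= g 0] it yields a strict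
   decrease of [f] along [Z]. *)
pose e := rho ^+ 2 / 2; have e0 : 0 < e by rewrite divr_gt0 ?exprn_gt0.
pose g s := f (Z s) + e * s.
suff : g t <= g 0.
  by rewrite /g mulr0 addr0 => H; rewrite (lt_le_trans _ H)// ltrDl mulr_gt0.
apply: (@lipschitz_nonincreasing _ _ _ (C * K + e) _ (ltW t0) _
  (countable_right_isolated (cell \o Z))).
  move=> u s /andP[u0 ut] /andP[s0 st]; rewrite /g opprD addrACA -mulrBr.
  rewrite (le_trans (ler_normD _ _))// normrM (gtr0_norm e0) mulrDl lerD2r.
  by rewrite (le_trans (fC _ _))// -mulrA ler_pM2l// ZK.
move=> s /andP[s0 st] /= nis.
have [h h0 Gh] := ZG s s0.
pose h' := Num.min h (t - s).
have h'0 : 0 < h' by rewrite lt_min h0 subr_gt0.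
have [u /andP[su uh] cu] : exists2 u, s < u < s + h' & cell (Z u) = cell (Z s).
  apply: contrapT => H; apply: nis; exists h' => // u su.
  by apply/eqP => cu; apply: H; exists u.
have uh1 : u < s + h by rewrite (lt_le_trans uh)// lerD2l ge_min lexx.
have uh2 : u < t.
  by rewrite (lt_le_trans uh)// -lerBrDl ge_min lexx orbT.
exists u; first by rewrite su ltW.
have := Gh u; rewrite su uh1 => /(_ isT); set v := _ *: _ => Gv.
have := Gf _ _ v (esym cu) Gv.
have us : 0 < u - s by rewrite subr_gt0.
have -> : Z u - Z s = - (u - s) *: v.
  by rewrite /v scalerA mulNr divff ?gt_eqF// scaleN1r opprB.
rewrite dotvZr => fE.
have vv : rho ^+ 2 <= dotv v v.
  apply: le_trans (sqr_norm_le_dotv v).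
  rewrite ler_sqr ?nnegrE ?(ltW rho0)//; apply: Grho; apply: GZ Gv.
  by rewrite s0 (le_trans (ltW st)).
have : (u - s) * rho ^+ 2 <= (u - s) * dotv v v by rewrite ler_pM2l.
have : 0 < (u - s) * rho ^+ 2 by rewrite mulr_gt0 ?exprn_gt0.
rewrite /g /e; lra.
Qed.

End Descent.

Lemma ultra_fmap (T U : Type) (f : T -> U) (F : set_system T) :
  UltraFilter F -> UltraFilter (f @ F).
Proof.
move=> UF; split=> [|G PG FG]; first exact: fmap_proper_filter.
apply/seteqP; split=> // A GA.
have [//|FnA] := in_ultra_setVsetC (f @^-1` A) UF.
have GnA : G (~` A) by apply: FG; exact: FnA.
have [x []] : exists x, (A `&` ~` A) x by exact: (@filter_ex _ _ PG _ (filterI GA GnA)).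
by [].
Qed.

(** The crude factor is positive also for [d = 0], which allows dividing by it. *)
Lemma enorm_le_norm (R : realType) (d : nat) (v : 'rV[R]_d) :
  enorm v <= d.+1%:R * `|v|.
Proof.
have v0 : 0 <= d.+1%:R * `|v| by rewrite mulr_ge0.
rewrite -(ger0_norm v0) -sqrtr_sqr ler_sqrt ?sqr_ge0//.
apply: (@le_trans _ _ (\sum_(i < d) `|v| ^+ 2)).
  apply: ler_sum => i _; rewrite -[leLHS]real_normK ?num_real// ler_sqr ?nnegrE//.
  exact: coord_le_norm.
rewrite sumr_const card_ord -[leLHS]mulr_natl exprMn ler_wpM2r ?sqr_ge0//.
by rewrite -natrX ler_nat (leq_trans (leqnSn _))// expnS leq_pmulr.
Qed.

(** * Discrete trajectories: drift, noise and rescaled time *)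

Section Dynamics.
Variables (R : realType) (d : nat).
Local Notation V := 'rV[R]_d.
Variables (alpha : nat -> R) (z y n : nat -> V) (G : V -> set V) (K : R).
Hypothesis alpha_gt0 : forall k, 0 < alpha k.
Hypothesis alpha_cvg0 : alpha k @[k --> \oo] --> 0.
Hypothesis alpha_unbounded : forall M : R, exists m, M <= \sum_(0 <= j < m) alpha j.
Hypothesis zS : forall k, z k.+1 = z k - alpha k *: (y k + n k).
Hypothesis noise_cvg : cvg ((\sum_(0 <= j < k) alpha j *: n j) @[k --> \oo]).
Hypothesis z_bounded : exists M, forall k, `|z k| <= M.
Hypothesis yG : forall k, G (z k) (y k).
Hypothesis K_gt0 : 0 < K.
Hypothesis yK : forall k, `|y k| <= K.
Hypothesis G_closed : forall x, closed (G x).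
Hypothesis G_convex : forall x v w (t : R), G x v -> G x w -> 0 <= t <= 1 ->
  G x (t *: v + (1 - t) *: w).
Hypothesis G_local : locally_contained G.

Definition clock m : R := \sum_(0 <= j < m) alpha j.
Definition noise m : V := \sum_(0 <= j < m) alpha j *: n j.
Definition drift m : V := \sum_(0 <= j < m) alpha j *: y j.

Lemma clockS m : clock m.+1 = clock m + alpha m.
Proof. by rewrite /clock big_nat_recr. Qed.

Lemma driftS m : drift m.+1 = drift m + alpha m *: y m.
Proof. by rewrite /drift big_nat_recr. Qed.

Lemma noiseS m : noise m.+1 = noise m + alpha m *: n m.
Proof. by rewrite /noise big_nat_recr. Qed.

Lemma zE m : z m = z 0 - drift m - noise m.
Proof.
elim: m => [|m IH]; first by rewrite /drift /noise !big_geq// !subr0.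
rewrite zS driftS noiseS {1}IH scalerDr !opprD -!addrA; congr (_ + _).
by rewrite !addrA; congr (_ + _); rewrite addrAC.
Qed.

Lemma clock_lt : {homo clock : k m / (k < m)%N >-> k < m}.
Proof.
by apply: homo_ltn => [? ? ?|m]; [exact: lt_trans|rewrite clockS ltrDl].
Qed.

Lemma clock_le : {homo clock : k m / (k <= m)%N >-> k <= m}.
Proof. by move=> k m; rewrite leq_eqVlt => /predU1P[->//|/clock_lt/ltW]. Qed.

Lemma zB k m : z k - z m = (drift m - drift k) + (noise m - noise k).
Proof.
rewrite (zE k) (zE m); apply/rowP => i; rewrite !mxE; ring.
Qed.

Lemma drift_bound k m : (k <= m)%N -> `|drift m - drift k| <= K * (clock m - clock k).
Proof.
elim: m => [|m IH]; first by rewrite leqn0 => /eqP ->; rewrite !subrr normr0 mulr0.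
rewrite leq_eqVlt => /predU1P[->|]; first by rewrite !subrr normr0 mulr0.
rewrite ltnS => /IH H; rewrite driftS clockS addrAC (le_trans (ler_normD _ _))//.
rewrite normrZ (gtr0_norm (alpha_gt0 _)).
have : alpha m * `|y m| <= alpha m * K by rewrite ler_pM2l.
lra.
Qed.

Lemma z_dist k m : (k <= m)%N ->
  `|z k - z m| <= K * (clock m - clock k) + `|noise m - noise k|.
Proof.
move=> km; rewrite zB (le_trans (ler_normD _ _))// lerD2r.
exact: drift_bound.
Qed.

(** The quotient is the average of [y k], ..., [y m.-1] with weights [alpha]; each induction step
    mixes the previous average with the newest term. *)
Lemma drift_convex (C : set V) k m :
  (forall v w (t : R), C v -> C w -> 0 <= t <= 1 -> C (t *: v + (1 - t) *: w)) ->
  (k < m)%N -> (forall j, (k <= j < m)%N -> C (y j)) ->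
  C ((clock m - clock k)^-1 *: (drift m - drift k)).
Proof.
move=> cC; elim: m => // m IH; rewrite ltnS leq_eqVlt => /predU1P[<-|km] yC.
  rewrite clockS driftS ![_ + _ - _]addrAC !subrr !add0r scalerA mulVf ?gt_eqF//.
  by rewrite scale1r; apply: yC; rewrite leqnn ltnSn.
have ckm : 0 < clock m - clock k by rewrite subr_gt0 clock_lt.
have am := alpha_gt0 m.
have : C ((clock m - clock k)^-1 *: (drift m - drift k)).
  by apply: IH => // j /andP[kj jm]; apply: yC; rewrite kj ltnS ltnW.
have : C (y m) by apply: yC; rewrite ltnW//= ltnSn.
move=> Cy Cd; have := cC _ _ ((clock m - clock k) / (clock m.+1 - clock k)) Cd Cy.
have E : clock m.+1 - clock k = clock m - clock k + alpha m by rewrite clockS addrAC.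
have E0 : 0 < clock m.+1 - clock k by rewrite E addr_gt0.
rewrite divr_ge0 ?(ltW ckm) ?(ltW E0)//= ler_pdivrMr// mul1r E lerDl (ltW am) => /(_ isT).
rewrite scalerA mulrAC divff ?gt_eqF// mul1r.
rewrite (_ : 1 - _ = alpha m / (clock m.+1 - clock k)); last first.
  by rewrite E; field; rewrite gt_eqF// -E.
by rewrite -E [alpha m / _]mulrC -scalerA -scalerDr driftS addrAC.
Qed.

(** The first index from [k] on at which [clock] has advanced by [t]. It exists because the steps
    have unbounded sum, so [xget] does not fall back on [0%N]. *)
Definition idx k (t : R) : nat :=
  xget 0%N [set m | [/\ (k <= m)%N, clock k + t <= clock m &
    forall j, (k <= j < m)%N -> clock j < clock k + t]].

Lemma idxP k t : [/\ (k <= idx k t)%N, clock k + t <= clock (idx k t) &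
    forall j, (k <= j < idx k t)%N -> clock j < clock k + t].
Proof.
rewrite /idx; case: xgetP => [m _ //|noidx]; exfalso.
have [m0 hm0] := alpha_unbounded (clock k + t).
have ex : exists m, (k <= m)%N && (clock k + t <= clock m).
  exists (maxn k m0); rewrite leq_maxl/= (le_trans hm0)// clock_le//.
  exact: leq_maxr.
case: (ex_minnP ex) => m /andP[km tm] mmin; apply: (noidx m); split=> // j /andP[kj jm].
by rewrite ltNge; apply/negP => tj; have := mmin j; rewrite kj tj leqNgt jm => /(_ isT).
Qed.

Lemma idx_le k s t : s <= t -> (idx k s <= idx k t)%N.
Proof.
move=> st; have [_ _ sP] := idxP k s; have [kt tP _] := idxP k t.
rewrite leqNgt; apply/negP => ts; have := sP _ (introT andP (conj kt ts)).
by rewrite ltNge (le_trans _ tP)// lerD2l.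
Qed.

Lemma idx0 k : idx k 0 = k.
Proof.
have [k0 _ H] := idxP k 0; apply/eqP; rewrite eqn_leq k0 andbT leqNgt.
by apply/negP => ki; have := H k; rewrite leqnn ki => /(_ isT); rewrite addr0 ltxx.
Qed.

Lemma idx_gt k t : 0 < t -> (k < idx k t)%N.
Proof.
move=> t0; have [k0 H _] := idxP k t; rewrite ltn_neqAle k0 andbT.
by apply: contraPneq H => <-; apply/negP; rewrite -ltNge ltrDl.
Qed.

(** The overshoot is at most the last step taken, which is small for late [k], uniformly in [t]. *)
Lemma idx_close (e : R) : 0 < e ->
  \forall k \near \oo, forall t, 0 <= t -> clock (idx k t) <= clock k + t + e.
Proof.
move=> e0; have /cvgrPdist_lt/(_ _ e0)[N _ Ne] := alpha_cvg0.
exists N => // k /= Nk t t0; have [ki _] := idxP k t.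
case: (idx k t) ki => [|m]; first by rewrite leqn0 => /eqP -> _; lra.
rewrite leq_eqVlt => /predU1P[->|km H]; first lra.
have := Ne m (leq_trans Nk km); rewrite sub0r normrN gtr0_norm// clockS.
have := H m; rewrite -ltnS km ltnSn => /(_ isT); lra.
Qed.

Lemma noise_small (e : R) : 0 < e ->
  \forall k \near \oo, forall m, (k <= m)%N -> `|noise m - noise k| < e.
Proof.
move=> e0; have e2 : 0 < e / 2 by rewrite divr_gt0.
have /cvgrPdist_lt/(_ _ e2)[N _ Ne] := noise_cvg.
exists N => // k /= Nk m km; have h1 := Ne k Nk; have h2 := Ne m (leq_trans Nk km).
rewrite -(subrKA (lim (noise k @[k --> \oo]))) (le_lt_trans (ler_normD _ _))//.
by rewrite [e]splitr ltrD// distrC.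
Qed.

Lemma z_step (e : R) : 0 < e -> \forall k \near \oo, `|z k - z k.+1| < e.
Proof.
move=> e0; have e2 : 0 < e / 2 by rewrite divr_gt0.
have eK : 0 < e / 2 / K by rewrite divr_gt0.
have /cvgrPdist_lt/(_ _ eK) := alpha_cvg0; apply: filterS2 (noise_small e2) => k kn.
rewrite sub0r normrN gtr0_norm// ltr_pdivlMr// => ak.
rewrite (le_lt_trans (z_dist (leqnSn k)))//.
have := kn k.+1 (leqnSn k); rewrite clockS; lra.
Qed.

(** * The limiting flow along an ultrafilter *)

Section Limit.
Variable F : set_system nat.
Hypothesis UF : UltraFilter F.
Hypothesis Foo : \oo `<=` F.

(** The position at time [t] after index [k], as [k] runs along [F]. The ultrafilter makes these
    bounded sequences converge for all [t] at once, in place of extracting subsequences. *)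
Definition flow (t : R) : V := lim (z (idx k t) @[k --> F]).

Lemma cvg_oo (T : Type) (u : nat -> T) (l : set_system T) :
  u k @[k --> \oo] --> l -> u k @[k --> F] --> l.
Proof. by move=> ul P /ul /Foo. Qed.

Lemma flow_cvg t : z (idx k t) @[k --> F] --> flow t.
Proof.
have [M zM] := z_bounded.
have : compact [set v : V | `|v| <= M].
  apply: bounded_closed_compact.
    by exists M; split; [exact: num_real|move=> x Mx v /= vM; exact: le_trans vM (ltW Mx)].
  have : continuous (fun v : V => `|v|) by exact: norm_continuous.
  by move=> /continuous_closedP/(_ [set x | x <= M]); apply; exact: closed_le.
rewrite compact_ultra => /(_ (z (idx k t) @[k --> F])) [||p [_ Fp]].
- exact: ultra_fmap.
- by apply: nearW => k /=.
- exact: (cvgP p).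
Qed.

Lemma clock_cvg t : 0 <= t -> clock (idx k t) - clock k @[k --> F] --> t.
Proof.
move=> t0; apply: cvg_oo; apply/cvgrPdist_le => e e0.
apply: filterS (idx_close e0) => k /(_ t t0) H; have [_ h _] := idxP k t.
rewrite ler_norml; apply/andP; split; lra.
Qed.

Lemma noise_cvg0 t : noise (idx k t) - noise k @[k --> F] --> (0 : V).
Proof.
apply: cvg_oo; apply/cvgrPdist_lt => e e0; apply: filterS (noise_small e0) => k.
by have [h _ _] := idxP k t => /(_ _ h); rewrite sub0r normrN.
Qed.

Lemma flow_lipschitz s t : 0 <= s -> 0 <= t -> `|flow s - flow t| <= K * `|s - t|.
Proof.
wlog st : s t / s <= t.
  by move=> W s0 t0; have [/W|/ltW/W] := leP s t; [exact|rewrite distrC [`|s - t|]distrC; exact].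
move=> s0 t0; rewrite [`|s - t|]distrC (@ger0_norm _ (t - s)) ?subr_ge0//.
have H1 : `|z (idx k s) - z (idx k t)| @[k --> F] --> `|flow s - flow t|.
  by apply: cvg_norm; apply: cvgB; exact: flow_cvg.
have H2 : K * ((clock (idx k t) - clock k) - (clock (idx k s) - clock k)) +
   `|(noise (idx k t) - noise k) - (noise (idx k s) - noise k)| @[k --> F] -->
   K * (t - s) + `|(0 : V) - 0|.
  apply: cvgD; first by apply: cvgM; [exact: cvg_cst|apply: cvgB; exact: clock_cvg].
  by apply: cvg_norm; apply: cvgB; exact: noise_cvg0.
have -> : K * (t - s) = K * (t - s) + `|(0 : V) - 0| by rewrite subrr normr0 addr0.
apply: (ler_cvg_to H1 H2).
apply: nearW => k.
rewrite [X in K * X](_ : _ = clock (idx k t) - clock (idx k s)); last by ring.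
rewrite [X in _ + `|X|](_ : _ = noise (idx k t) - noise (idx k s)).
  exact: z_dist (idx_le k st).
by apply/rowP => i; rewrite !mxE; ring.
Qed.

(** Between [idx k t] and [idx k s] the iterates remain within [r] of [flow t], so their [y j] lie
    in [G (flow t)], and by convexity so does the averaged drift. It tends to the quotient because
    the noise increments vanish; [G (flow t)] is closed. *)
Lemma flow_inclusion t : 0 <= t -> exists2 h, 0 < h &
  forall s, t < s < t + h -> G (flow t) ((s - t)^-1 *: (flow t - flow s)).
Proof.
move=> t0; have [r r0 Gr] := G_local (flow t).
have K8 : 0 < 8 * K by rewrite mulr_gt0.
(* The distance [r] is spent in quarters: one for the convergence to [flow t], one for the drift
   over clock time [2 * h], two for the noise. *)
pose h := r / (8 * K); have h0 : 0 < h by rewrite divr_gt0.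
exists h => // s /andP[ts sh]; have st0 : 0 < s - t by rewrite subr_gt0.
have r4 : 0 < r / 4 by rewrite divr_gt0.
have s0 : 0 <= s by rewrite (le_trans t0)// ltW.
(* An overshoot of at most [h] keeps the elapsed clock time within [2 * h]; one of at most half of
   [s - t] forces [idx k t < idx k s]. *)
pose e := Num.min h ((s - t) / 2).
have e0 : 0 < e by rewrite lt_min h0 divr_gt0.
pose W k := (clock (idx k s) - clock (idx k t))^-1 *: (drift (idx k s) - drift (idx k t)).
have Wcvg : W k @[k --> F] --> (s - t)^-1 *: (flow t - flow s).
  have -> : W = fun k => ((clock (idx k s) - clock k) - (clock (idx k t) - clock k))^-1 *:
     ((z (idx k t) - z (idx k s)) - ((noise (idx k s) - noise k) - (noise (idx k t) - noise k))).
    apply/funext => k; rewrite /W zB; congr (_^-1 *: _); first by ring.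
    by apply/rowP => i; rewrite !mxE; ring.
  have -> : flow t - flow s = flow t - flow s - (0 - 0) by rewrite !subr0.
  apply: cvgZ; first by apply: cvgV; [rewrite gt_eqF|apply: cvgB; exact: clock_cvg].
  by apply: cvgB; apply: cvgB; [exact: flow_cvg|exact: flow_cvg|exact: noise_cvg0|exact: noise_cvg0].
apply: (closed_cvg _ (@G_closed (flow t)) _ _ Wcvg).
have /cvgrPdist_lt/(_ _ r4) := @flow_cvg t.
apply: filterS3 (Foo (noise_small r4)) (Foo (idx_close e0)) => k kn kc kz.
have [it ct _] := idxP k t; have [is_ cs _] := idxP k s.
have its : (idx k t < idx k s)%N.
  rewrite ltn_neqAle idx_le ?(ltW ts)// andbT; apply/eqP => E.
  have := kc t t0; rewrite E; have : e <= (s - t) / 2 by rewrite ge_min lexx orbT.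
  lra.
apply: drift_convex => //; first exact: G_convex.
move=> j /andP[tj js]; apply: (Gr (z j)) => //.
have kj : (k <= j)%N := leq_trans it tj.
rewrite -(subrKA (z (idx k t))) (le_lt_trans (ler_normD _ _))//.
have h1 := z_dist tj; rewrite distrC in h1.
have h2 : clock j - clock (idx k t) <= 2 * h.
  have := clock_le (ltnW js); have := kc s s0.
  have : e <= h by rewrite ge_min lexx.
  lra.
have h3 : `|noise j - noise (idx k t)| < r / 4 + r / 4.
  rewrite -(subrKA (noise k)) (le_lt_trans (ler_normD _ _))// ltrD ?kn//.
  by rewrite distrC kn.
have h4 : K * (clock j - clock (idx k t)) <= K * (2 * h) by rewrite ler_pM2l.
have h5 : K * (2 * h) = r / 4 by rewrite /h; field; rewrite gt_eqF.
rewrite distrC in kz; lra.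
Qed.

Lemma flow0 : z k @[k --> F] --> flow 0.
Proof. by have := @flow_cvg 0; under eq_fun do rewrite idx0. Qed.

End Limit.

(** An infinite [A] and the tails generate a proper filter, which extends to an ultrafilter: the
    substitute for a subsequence inside [A]. *)
Lemma frequently_ultra (A : set nat) : (forall N, exists2 k, (N <= k)%N & A k) ->
  exists F, [/\ UltraFilter F, \oo `<=` F & F A].
Proof.
move=> freq.
have PW : ProperFilter (within A \oo).
  apply: Build_ProperFilter_ex => P [N _ NP].
  by have [k Nk Ak] := freq N; exists k; exact: NP.
have [F [UF WF]] := ultraFilterLemma PW; exists F; split=> //.
- by move=> P oP; apply: WF; apply: filterS oP => k Pk _.
- by apply: WF; exists 0%N.
Qed.

(** * Values of [f] along the flow and criticality of limit points *)

Variables (T : finType) (cell : V -> T) (f : V -> R).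
Hypothesis f_lipschitz : lipschitz_fun f.
Hypothesis f_cell : cell_gradient cell f G.

Lemma f_cvg (F : set_system nat) (PF : ProperFilter F) (u : nat -> V) (l : V) :
  u k @[k --> F] --> l -> f (u k) @[k --> F] --> f l.
Proof.
move=> ul; have [C C0 fC] := f_lipschitz; apply/cvgrPdist_lt => e e0.
have eC : 0 < e / C by rewrite divr_gt0.
move/cvgrPdist_lt : ul => /(_ _ eC); apply: filterS => k.
by rewrite ltr_pdivlMr// mulrC; exact: le_lt_trans (fC _ _).
Qed.

Lemma flow_descent F : UltraFilter F -> \oo `<=` F -> ~ G (flow F 0) 0 ->
  exists2 b, 0 < b & forall t, 0 < t <= b -> f (flow F t) < f (flow F 0).
Proof.
move=> UF Foo; apply: (@strict_descent _ _ _ cell f G K (flow F)) => //.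
- exact: flow_lipschitz.
- exact: flow_inclusion.
Qed.

(** Two critical points of one cell have equal values, by the cell identity with [v = 0]; the values
    are thus indexed by the finite type [T]. *)
Lemma countable_critical_values : countable [set f x | x in [set x | G x 0]].
Proof.
have [g gE] : exists g : T -> R, forall x, G x 0 -> g (cell x) = f x.
  have /choice[g gE] : forall t, exists r : R, forall x, G x 0 -> cell x = t -> r = f x.
    move=> t; have [[x [Gx <-]]|nx] := pselect (exists x, G x 0 /\ cell x = t); last first.
      by exists 0 => x Gx xt; exfalso; apply: nx; exists x.
    exists (f x) => x' Gx' /esym/f_cell/(_ Gx); rewrite dot0v => /eqP.
    by rewrite subr_eq0 => /eqP.
  by exists g => x Gx; exact: gE.
apply: (@sub_countable _ _ _ (range g)).
  by apply: subset_card_le => _ [x Gx <-]; exists (cell x) => //; exact: gE.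
exact: sub_countable (card_image_le g setT) (countableP _).
Qed.

Lemma last_below (u : nat -> R) (c : R) k m : (k <= m)%N -> u k <= c -> c < u m ->
  exists2 j, (k <= j < m)%N & u j <= c /\ forall i, (j < i <= m)%N -> c < u i.
Proof.
elim: m => [|m IH]; first by rewrite leqn0 => /eqP -> /le_lt_trans h /h; rewrite ltxx.
rewrite leq_eqVlt => /predU1P[->|]; first by move=> /le_lt_trans h /h; rewrite ltxx.
rewrite ltnS => km uk um; have [umc|umc] := leP (u m) c.
  exists m; first by rewrite km ltnSn.
  by split=> // i /andP[mi im]; have -> : i = m.+1 by apply/eqP; rewrite eqn_leq im.
have [j /andP[kj jm] [uj Hj]] := IH km uk umc.
exists j; first by rewrite kj ltnS ltnW.
split=> // i /andP[ji]; rewrite leq_eqVlt => /predU1P[-> //|im].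
by apply: Hj; rewrite ji -ltnS.
Qed.

(** Let an ultrafilter follow the last indices at level at most [c] before a climb to [c']. The
    limit point has value exactly [c], so it is not critical and the flow drops below [c] at once;
    yet a climb takes a minimal clock time, during which the values stay above [c]. *)
Lemma no_upcrossing (c c' : R) : c < c' -> (forall x, G x 0 -> f x <> c) ->
  (forall N, exists2 k, (N <= k)%N & f (z k) <= c) ->
  (forall N, exists2 k, (N <= k)%N & c' <= f (z k)) -> False.
Proof.
move=> cc' crit low high; have [C C0 fC] := f_lipschitz.
pose A := [set k | f (z k) <= c /\ exists m, [/\ (k < m)%N, c' <= f (z m) &
  forall j, (k < j <= m)%N -> c < f (z j)]].
have [|F [UF Foo FA]] := @frequently_ultra A.
  move=> N; have [k Nk fk] := low N; have [m km fm] := high k.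
  have [j /andP[kj jm] [uj Hj]] := @last_below (f \o z) c k m km fk (lt_le_trans cc' fm).
  by exists j; [exact: leq_trans kj|split=> //; exists m].
have z0 := flow0 UF.
have fz0 := f_cvg (@ultra_proper _ _ UF) z0.
have f0le : f (flow F 0) <= c.
  by apply: (cvgr_to_le fz0); apply: filterS FA => k [].
have f0ge : c <= f (flow F 0).
  (* For indices in [A] the next iterate is already above [c]; steps tend to 0, so it has the same
     limit. *)
  have z1 : z k.+1 @[k --> F] --> flow F 0.
    rewrite -[flow F 0]subr0.
    have -> : (fun k => z k.+1) = fun k => z k - (z k - z k.+1).
      by apply/funext => k; rewrite subKr.
    apply: cvgB => //; apply: (cvg_oo Foo); apply/cvgrPdist_lt => e /z_step.
    by apply: filterS => k; rewrite sub0r normrN.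
  apply: (cvgr_to_ge (f_cvg (@ultra_proper _ _ UF) z1)).
  by apply: filterS FA => k [_ [m [km _ H]]]; apply/ltW/H; rewrite ltnSn.
have f0 : f (flow F 0) = c by apply/le_anti; rewrite f0le.
have [b b0 bf] : exists2 b, 0 < b & forall t, 0 < t <= b -> f (flow F t) < f (flow F 0).
  by apply: flow_descent => // /crit.
(* A climb covers at least the distance [e], by the Lipschitz bound. Noise accounts for less than
   half of it, so the drift needs at least the clock time [del] for the rest. *)
pose e := (c' - c) / C; have e0 : 0 < e by rewrite divr_gt0// subr_gt0.
have e2 : 0 < e / 2 by rewrite divr_gt0.
pose del := e / 2 / K; have del0 : 0 < del by rewrite divr_gt0.
pose t := Num.min b del; have t0 : 0 < t by rewrite lt_min b0.
have : c <= f (flow F t).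
  have ft := @f_cvg F (@ultra_proper _ _ UF) (fun k => z (idx k t)) _ (flow_cvg UF (t:=t)).
  apply: (cvgr_to_ge ft).
  apply: filterS2 FA (Foo _ (noise_small e2)) => k [fk [m [km fm H]]] kn.
  apply/ltW/H; rewrite idx_gt//=.
  have [_ _ Ht] := idxP k t; rewrite leqNgt; apply/negP => mi.
  have := Ht m; rewrite (ltnW km) mi => /(_ isT).
  have h1 := z_dist (ltnW km); have h2 := kn m (ltnW km).
  have h3 : c' - c <= C * `|z k - z m|.
    rewrite distrC; apply: le_trans (fC _ _); rewrite ger0_norm; lra.
  have h4 : e <= `|z k - z m| by rewrite ler_pdivrMr// mulrC.
  have h5 : t <= del by rewrite ge_min lexx orbT.
  have h6 : K * t <= e / 2 by rewrite mulrC -ler_pdivlMr.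
  move=> h7; have h8 : K * (clock m - clock k) < K * t by rewrite ltr_pM2l//; lra.
  lra.
by rewrite leNgt -f0 bf// t0 ge_min lexx.
Qed.

(** From a noncritical limit point the flow falls to a smaller value. The iterates come close to
    both values infinitely often, so they cross a noncritical level in between upwards infinitely
    often. *)
Lemma limit_critical F : UltraFilter F -> \oo `<=` F -> G (flow F 0) 0.
Proof.
move=> UF Foo; apply: contrapT => /(flow_descent UF Foo)[b b0 bf].
have := bf b; rewrite b0 lexx => /(_ isT) fb.
have [c [c1 c2 ccrit]] := exists_between_notin countable_critical_values fb.
have [c' /andP[cc' c'2]] : exists c', c < c' < f (flow F 0).
  by exists ((c + f (flow F 0)) / 2); apply/andP; split; lra.
have fN N : F [set k | (N <= k)%N] by apply: Foo; exact: nbhs_infty_ge.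
apply: (@no_upcrossing c c') => //.
- by move=> x Gx fx; apply: ccrit; exists x.
- move=> N; have fcvg :=
    @f_cvg F (@ultra_proper _ _ UF) (fun k => z (idx k b)) _ (flow_cvg UF (t:=b)).
  have : F [set k | f (z (idx k b)) <= c].
    by apply: filterS (cvgr_lt _ fcvg _ c1) => k /ltW.
  move=> /(filterI (fN N))/filter_ex[k [Nk fk]]; exists (idx k b) => //.
  by have [ki _ _] := idxP k b; exact: leq_trans ki.
- move=> N; have fcvg := f_cvg (@ultra_proper _ _ UF) (flow0 UF).
  have : F [set k | c' <= f (z k)].
    by apply: filterS (cvgr_gt _ fcvg _ c'2) => k /ltW.
  by move=> /(filterI (fN N))/filter_ex[k [Nk fk]]; exists k.
Qed.

Lemma dist_critical_cvg0 :
  edist_to (z k) [set x | G x 0] @[k --> \oo] --> 0%E.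
Proof.
set S := [set x | G x 0].
have dist0 k : (0 <= edist_to (z k) S)%E.
  by apply: le_ereal_inf_tmp => _ [x _ <-]; rewrite lee_fin sqrtr_ge0.
have small (e : R) : 0 < e ->
    \forall k \near \oo, (edist_to (z k) S <= e%:E)%E.
  move=> e0; apply: contrapT => H.
  (* A distance above [e] occurring infinitely often would persist along an ultrafilter, whose limit
     point is critical. *)
  have [|F [UF Foo FA]] := @frequently_ultra
      [set k | (e%:E < edist_to (z k) S)%E].
    move=> N; apply: contrapT => N'; apply: H; exists N => // k /= Nk.
    by rewrite leNgt; apply/negP => ek; apply: N'; exists k.
  have ed : 0 < e / d.+1%:R by rewrite divr_gt0.
  have /cvgrPdist_lt/(_ _ ed) zF := flow0 UF.
  have [k /= [ek zk]] := filter_ex (filterI FA zF).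
  have : (edist_to (z k) S <= (enorm (z k - flow F 0))%:E)%E.
    by apply: ereal_inf_lbound; exists (flow F 0) => //; exact: limit_critical.
  move=> /(lt_le_trans ek); rewrite lte_fin ltNge => /negP; apply.
  rewrite (le_trans (enorm_le_norm _))// mulrC -ler_pdivlMr// distrC.
  exact: ltW.
apply/fine_cvgP; split.
  apply: filterS (small 1 ltr01) => k k1.
  by rewrite ge0_fin_numE// (le_lt_trans k1)// ltry.
apply/cvgrPdist_le => e e0; apply: filterS (small e e0) => k ke /=.
have fin : edist_to (z k) S \is a fin_num.
  by rewrite ge0_fin_numE// (le_lt_trans ke)// ltry.
by rewrite sub0r normrN ger0_norm ?fine_ge0// -lee_fin fineK.
Qed.

End Dynamics.

(** * Confinement under an inward drift *)

Lemma confined_bounded (R : realType) (alpha x p q : nat -> R) (A C M N : R) :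
  (forall k, 0 < alpha k <= A) -> (forall k, `|p k| <= C) ->
  (forall m, `|\sum_(0 <= j < m) alpha j * q j| <= N) ->
  (forall k, x k.+1 = x k - alpha k * (p k + q k)) ->
  (forall k, M < x k -> 0 <= p k) -> (forall k, x k < - M -> p k <= 0) -> 0 <= M ->
  exists B, forall k, `|x k| <= B.
Proof.
move=> aA pC qN xS pM pm M0.
(* Adding the noise sums back leaves a sequence moved by the drift alone. *)
pose S m := \sum_(0 <= j < m) alpha j * q j; pose u k := x k + S k.
have uS k : u k.+1 = u k - alpha k * p k.
  by rewrite /u /S big_nat_recr//= xS; ring.
have N0 : 0 <= N by apply: le_trans (qN 0%N).
have C0 : 0 <= C by apply: le_trans (pC 0%N).
have A0 : 0 < A by have /andP[h1 h2] := aA 0%N; exact: lt_le_trans h2.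
(* Room for the start, the inner band [M], the noise [N], and one drift step of size at most [A * C]
   leaving the band. *)
pose U := `|u 0%N| + M + N + A * C.
have AC0 : 0 <= A * C by rewrite mulr_ge0// ltW.
have u0 : 0 <= `|u 0%N| by [].
have uU k : - U <= u k <= U.
  elim: k => [|k /andP[IH1 IH2]].
    rewrite -ler_norml /U; lra.
  have /andP[a0 aA'] := aA k; have := pC k; rewrite ler_norml => /andP[pl pr].
  have := qN k; rewrite ler_norml -/(S k) => /andP[ql qr].
  have h1 : alpha k * p k <= A * C.
    apply: (@le_trans _ _ (alpha k * C)); first by rewrite ler_pM2l.
    by rewrite ler_wpM2r.
  have h2 : - (A * C) <= alpha k * p k.
    rewrite lerNl -mulrN; apply: (@le_trans _ _ (alpha k * C)); last by rewrite ler_wpM2r.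
    by rewrite ler_pM2l// lerNl.
  rewrite uS; have [xM|xM] := ltP M (x k).
    have : 0 <= alpha k * p k by rewrite mulr_ge0 ?pM// ltW.
    have : u k = x k + S k by [].
    rewrite /U in IH1 IH2 *; lra.
  have [xm|xm] := ltP (x k) (- M).
    have : alpha k * p k <= 0 by rewrite mulr_ge0_le0 ?pm// ltW.
    have : u k = x k + S k by [].
    rewrite /U in IH1 IH2 *; lra.
  have : u k = x k + S k by [].
  rewrite /U in IH1 IH2 *; lra.
exists (U + N) => k; have /andP[h1 h2] := uU k.
have := qN k; rewrite ler_norml -/(S k) => /andP[ql qr].
have : u k = x k + S k by [].
by rewrite ler_norml => H; apply/andP; split; lra.
Qed.

Lemma cvg_rV (R : realType) (d : nat) (T : Type) (F : set_system T)
    (u : T -> 'rV[R]_d) : Filter F ->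
  (forall i, cvg (u k ord0 i @[k --> F])) -> cvg (u k @[k --> F]).
Proof.
move=> FF ucvg; apply/cvg_ex; exists (\row_i lim (u k ord0 i @[k --> F])).
apply/cvgrPdist_lt => e e0.
have : \forall k \near F, forall i : 'I_d, `|lim (u k ord0 i @[k --> F]) - u k ord0 i| < e.
  apply: filter_forall => i.
  by have /cvgrPdist_lt/(_ _ e0) := ucvg i.
apply: filterS => k uk; rewrite -[X in X < _]/(mx_norm _) mx_normrE.
by apply/bigmax_ltP; split=> // -[a i] _ /=; rewrite !mxE (ord1 a).
Qed.

(** * Convergence of the placement iterates on one sample path *)

Section PlacementDynamics.
Variables (R : realType) (n : nat) (D : placement R n.+1) (L B : R).
Local Notation V := 'rV[R]_(n.+1 * 2).
Variables (alpha : nat -> R) (z v s xi y : nat -> V).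
Hypothesis alpha_gt0 : forall k, 0 < alpha k.
Hypothesis alpha_cvg0 : alpha k @[k --> \oo] --> 0.
Hypothesis alpha_unbounded : forall M : R, exists m, M <= \sum_(0 <= j < m) alpha j.
Hypothesis hL : forall z v, clarke (f0 D) z v -> enorm v <= L.
Hypothesis hB : forall z s, clarke (fb D) z s -> enorm s <= B.
Hypothesis hmu : L < min_bnd_pen D.
Hypothesis hv : forall k, clarke (f0 D) (z k) (v k).
Hypothesis hs : forall k, clarke (fb D) (z k) (s k).
Hypothesis hy : forall k, clarke (objective D) (z k) (y k).
Hypothesis hz : forall k, z k.+1 = z k - alpha k *: (v k + s k + xi k).

(** Where a coordinate exceeds [outer_len] in modulus, [s] contributes exactly [bnd_pen D i] with
    the sign of that coordinate, and [v] at most [L] in modulus. As [L < min_bnd_pen D], the sign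
    conditions of [confined_bounded] hold. *)
Lemma iterates_bounded :
  (forall i, cvg ((\sum_(0 <= j < k) alpha j * xi j ord0 i) @[k --> \oo])) ->
  exists M, forall k, `|z k| <= M.
Proof.
move=> xicvg.
have [A aA] : exists A, forall k, alpha k <= A.
  have /cvg_seq_bounded[A [_ hA]] : cvg (alpha k @[k --> \oo]) by apply/cvg_ex; exists 0.
  by exists (A + 1) => k; apply: le_trans (ler_norm _) _; apply: (hA (A + 1) _ k I); rewrite ltrDl.
have coord (j : 'I_(n.+1 * 2)) : exists M, forall k, `|z k ord0 j| <= M.
  case/mxvec_indexP: j => i b.
  have /cvg_seq_bounded[N [_ hN]] := xicvg (mxvec_index i b).
  apply: (@confined_bounded _ alpha _ (fun k => v k ord0 (mxvec_index i b) +
       s k ord0 (mxvec_index i b)) (fun k => xi k ord0 (mxvec_index i b))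
       A (L + B) (outer_len D i b) (N + 1)).
  - by move=> k; rewrite alpha_gt0 aA.
  - move=> k; rewrite (le_trans (ler_normD _ _))//.
    by apply: lerD; apply: (le_trans (coord_le_enorm _ _));
      [exact: (@hL _ _ (@hv k))|exact: (@hB _ _ (@hs k))].
  - by move=> m; apply: (hN (N + 1) _ m I); rewrite ltrDl.
  - by move=> k; rewrite hz !mxE.
  - move=> k; rewrite -crdE => zM; rewrite -!crdE (clarke_fb_gt zM (@hs k)) crdE.
    have := le_trans (coord_le_enorm (v k) (mxvec_index i b)) (@hL _ _ (@hv k)).
    rewrite ler_norml => /andP[]; have := min_bnd_pen_le D i; have := hmu; lra.
  - move=> k; rewrite -crdE => zM; rewrite -!crdE (clarke_fb_lt zM (@hs k)) crdE.
    have := le_trans (coord_le_enorm (v k) (mxvec_index i b)) (@hL _ _ (@hv k)).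
    rewrite ler_norml => /andP[]; have := min_bnd_pen_le D i; have := hmu; lra.
  - by rewrite addr_ge0 ?ltW ?side_len_gt0 ?region_len_gt0.
have /choice[M zM] := coord.
exists (\big[Num.max/0]_j M j) => k.
rewrite -[leLHS]/(mx_norm _) mx_normrE; apply: bigmax_le.
  by apply: bigmax_ge_id.
move=> [a j] _ /=; rewrite (ord1 a) (le_trans (zM j k))//.
exact: le_bigmax_cond.
Qed.

(** The sum [v k + s k] need not be a Clarke subgradient of the objective, so the drift is [y k],
    and [v k + s k - y k] is counted as noise together with [xi k]. *)
Lemma placement_dist_cvg0 :
  (forall i, cvg ((\sum_(0 <= j < k) alpha j * xi j ord0 i) @[k --> \oo])) ->
  (forall i, cvg ((\sum_(0 <= j < k) alpha j * (v j + s j - y j) ord0 i) @[k --> \oo])) ->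
  edist_to (z k) [set x | clarke (objective D) x 0] @[k --> \oo] --> 0%E.
Proof.
move=> xicvg mcvg.
have [[K K0 fK] fconic [T [cell fcell]]] := pwl_objective D.
apply: (@dist_critical_cvg0 _ _ alpha z y (fun k => v k + s k - y k + xi k)
  (clarke (objective D)) (K * (n.+1 * 2).+1%:R) alpha_gt0 alpha_cvg0
  alpha_unbounded _ _ (iterates_bounded xicvg) hy _ _ _ _ _ T cell (objective D)).
- move=> k; rewrite hz; congr (_ - _ *: _); apply/rowP => i; rewrite !mxE; ring.
- apply: cvg_rV => i.
  rewrite [X in cvg (X @ _)](_ : _ = fun k =>
    \sum_(0 <= j < k) alpha j * (v j + s j - y j) ord0 i +
    \sum_(0 <= j < k) alpha j * xi j ord0 i); first exact: is_cvgD (mcvg i) (xicvg i).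
  apply/funext => k; rewrite summxE -big_split/=; apply: eq_bigr => j _.
  by rewrite !mxE; ring.
- by rewrite mulr_gt0.
- move=> k; rewrite -[leLHS]/(mx_norm _) mx_normrE; apply: bigmax_le => [|[a j] _ /=].
    by rewrite mulr_ge0// ltW.
  rewrite (ord1 a) (le_trans (clarke_bound (ltW K0) fK (@hy k) j))//.
  by apply: ler_peMr; [exact: ltW|rewrite ler1n].
- by move=> x; exact: clarke_closed.
- by move=> x w w' t; exact: clarke_convex.
- by move=> x; exact: clarke_conic.
- by exists K.
- by move=> x x' w /fcell/clarke_affine_along H /H.
Qed.

End PlacementDynamics.

(** * Almost sure convergence of the noise *)

Section Filtration.
Variables (R : realType) (disp : measure_display) (Omega : measurableType disp).
Variable P : probability Omega R.
Implicit Types (X Y : Omega -> R) (F : set (set Omega)).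

Definition fmeasurable F X := forall B : set R, measurable B -> F (X @^-1` B).

Definition sub_sigma F := sigma_algebra [set: Omega] F /\ F `<=` measurable.

Definition L1 X := P.-integrable setT (EFin \o X).

Lemma fmeasurableE F X : sigma_algebra [set: Omega] F ->
  fmeasurable F X <-> measurable_fun [set: g_sigma_algebraType F] (X : g_sigma_algebraType F -> R).
Proof.
move=> sF; split => [FX _ B mB|mX B mB].
  by rewrite setTI; apply: sub_sigma_algebra; exact: FX.
have := mX measurableT B mB; rewrite setTI.
by rewrite measurable_g_measurableTypeE.
Qed.

Lemma fmeasurable_measurable F X : sub_sigma F -> fmeasurable F X -> measurable_fun setT X.
Proof. by move=> [_ mF] FX _ B mB; rewrite setTI; apply: mF; exact: FX. Qed.

(** The sum counts the grid levels not above [y]; it is [y] rounded down to a multiple of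
    [m.+1%:R^-1]. *)
Lemma grid_approx (y b : R) (m : nat) : 0 <= y <= b ->
  `|y - \sum_(0 <= i < (Num.trunc (b * m.+1%:R)).+1)
     m.+1%:R^-1 * (i.+1%:R <= y * m.+1%:R)%R%:R| <= m.+1%:R^-1.
Proof.
move=> /andP[y0 yb]; have m0 : 0 < m.+1%:R :> R by rewrite ltr0n.
have ym0 : 0 <= y * m.+1%:R by rewrite mulr_ge0// (ltW m0).
have bm0 : 0 <= b * m.+1%:R by rewrite mulr_ge0// ?(ltW m0)// (le_trans y0).
have /andP[t1 t2] := truncn_itv ym0; have /andP[s1 s2] := truncn_itv bm0.
set t := Num.trunc (y * m.+1%:R) in t1 t2 *; set N := Num.trunc _ in s1 s2 *.
have tN : (t <= N.+1)%N.
  by rewrite -(ler_nat R) (le_trans t1)// (le_trans _ (ltW s2))// ler_pM2r.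
rewrite -mulr_sumr (big_cat_nat _ (n := t))//=.
rewrite [X in _ * (X + _)](_ : _ = t%:R); last first.
  rewrite (@eq_big_nat _ _ _ _ _ _ (fun=> 1)) ?sumr_const_nat ?subn0// => i /andP[_ it].
  by rewrite (_ : _ <= _ = true)// (le_trans _ t1)// ler_nat.
rewrite [X in _ * (_ + X)]big_nat_cond big1 ?addr0; last first.
  move=> i /andP[/andP[ti _] _]; rewrite (_ : _ <= _ = false)//.
  by apply/negbTE; rewrite -ltNge (lt_le_trans t2)// ler_nat.
have -> : y - m.+1%:R^-1 * t%:R = m.+1%:R^-1 * (y * m.+1%:R - t%:R).
  by field; rewrite gt_eqF.
rewrite normrM ger0_norm ?invr_ge0 ?(ltW m0)// ler_piMr ?invr_ge0 ?(ltW m0)//.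
rewrite ger0_norm ?subr_ge0// lerBlDr; rewrite -addn1 natrD in t2; lra.
Qed.

Lemma L1D X Y : L1 X -> L1 Y -> L1 (fun w => X w + Y w).
Proof.
by move=> iX iY; have := integrableD measurableT iX iY; apply: eq_integrable.
Qed.

Lemma L1Zl c X : L1 X -> L1 (fun w => c * X w).
Proof.
by move=> iX; have := integrableZl measurableT c iX; apply: eq_integrable.
Qed.

Lemma L1_cst c : L1 (cst c).
Proof. exact: finite_measure_integrable_cst. Qed.

Lemma L1_sum (N : nat) (h : nat -> Omega -> R) :
  (forall i, L1 (h i)) -> L1 (fun w => \sum_(0 <= i < N) h i w).
Proof.
move=> ih; elim: N => [|N IH].
  by under eq_fun do rewrite big_geq//; exact: L1_cst.
by under eq_fun do rewrite big_nat_recr//=; exact: L1D.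
Qed.

Lemma Rintegral_nat_sum (N : nat) (h : nat -> Omega -> R) : (forall i, L1 (h i)) ->
  \int[P]_w (\sum_(0 <= i < N) h i w) = \sum_(0 <= i < N) \int[P]_w h i w.
Proof.
move=> ih; elim: N => [|N IH].
  under eq_Rintegral do rewrite big_geq//; rewrite big_geq//.
  by rewrite Rintegral_cst// mul0r.
under eq_Rintegral do rewrite big_nat_recr//=.
by rewrite RintegralD ?IH ?big_nat_recr//; [exact: L1_sum|exact: ih].
Qed.

Lemma L1_dominated X Y : measurable_fun setT X -> L1 Y ->
  (forall w, `|X w| <= `|Y w|) -> L1 X.
Proof.
move=> mX iY XY; apply: le_integrable iY => //; first exact/measurable_EFinP.
by move=> w _ /=; rewrite lee_fin.
Qed.

(* A bounded [F]-measurable factor is a uniform limit of combinations of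
   indicators of sets of [F]. *)
Lemma pull_out_bounded F X Y (b : R) : sub_sigma F -> L1 Y ->
  (forall A, F A -> \int[P]_(w in A) Y w = 0) ->
  fmeasurable F X -> (forall w, `|X w| <= b) -> \int[P]_w (Y w * X w) = 0.
Proof.
move=> sF iY Y0 FX Xb; have mX := fmeasurable_measurable sF FX.
have mY : measurable_fun setT Y by have /integrableP[/measurable_EFinP] := iY.
have b0 : 0 <= b by apply: le_trans (Xb point).
(* The shift makes the factor nonnegative for [grid_approx]; it leaves the integral unchanged, since
   [Y] has integral 0. *)
pose Z w := X w + b; have Z0 w : 0 <= Z w <= b + b.
  by have := Xb w; rewrite ler_norml /Z => /andP[]; lra.
have FT : F setT by rewrite -(preimage_setT X); exact: FX.
pose A m i := [set w | i.+1%:R <= Z w * m.+1%:R].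
have FA m i : F (A m i).
  rewrite (_ : A m i = X @^-1` `[i.+1%:R / m.+1%:R - b, +oo[%classic); first exact: FX.
  apply/seteqP; split => w; rewrite /A /Z /= in_itv/= andbT lerBlDr ler_pdivrMr ?ltr0n//.
have mA m i : measurable (A m i) by apply: sF.2.
pose Q m w : R := \sum_(0 <= i < (Num.trunc ((b + b) * m.+1%:R)).+1)
     m.+1%:R^-1 * (i.+1%:R <= Z w * m.+1%:R)%R%:R.
have iYA m i : L1 (fun w => Y w * (i.+1%:R <= Z w * m.+1%:R)%R%:R).
  apply: (L1_dominated _ iY) => [|w]; last first.
    by case: (i.+1%:R <= _); rewrite /= ?mulr1 ?mulr0 ?normr0.
  apply: measurable_funM => //; have := @measurable_indic _ _ R setT _ (mA m i).
  apply: eq_measurable_fun => w _; rewrite indicE.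
  by congr (nat_of_bool _)%:R; apply/idP/idP => /=; rewrite inE.
have YA0 m i : \int[P]_w (Y w * (i.+1%:R <= Z w * m.+1%:R)%R%:R) = 0.
  rewrite -(Y0 _ (FA m i)) [RHS]Rintegral_mkcond; apply: eq_Rintegral => w _.
  rewrite patchE; have [Aw|/negP Aw] := boolP (i.+1%:R <= Z w * m.+1%:R).
    by rewrite mem_set// mulr1.
  by rewrite memNset// mulr0.
have QE m w : Y w * Q m w = \sum_(0 <= i < (Num.trunc ((b + b) * m.+1%:R)).+1)
     m.+1%:R^-1 * (Y w * (i.+1%:R <= Z w * m.+1%:R)%R%:R).
  by rewrite mulr_sumr; apply: eq_bigr => i _; rewrite mulrCA.
have iYQ m : L1 (fun w => Y w * Q m w).
  by under eq_fun do rewrite QE; apply: L1_sum => i; exact: L1Zl.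
have YQ0 m : \int[P]_w (Y w * Q m w) = 0.
  under eq_Rintegral do rewrite QE.
  rewrite Rintegral_nat_sum => [|i]; last exact: L1Zl.
  by rewrite big1// => i _; rewrite (RintegralZl _ measurableT (iYA m i)) YA0 mulr0.
have YT : \int[P]_w Y w = 0 by exact: Y0.
have iYX : L1 (fun w => Y w * X w).
  apply: (L1_dominated _ (L1Zl b iY)) => [|w]; first exact: measurable_funM.
  by rewrite !normrM mulrC ler_wpM2r// (ger0_norm b0).
have iYZ m : L1 (fun w => Y w * (Z w - Q m w)).
  have := L1D (L1D iYX (L1Zl b iY)) (L1Zl (-1) (iYQ m)).
  by apply: eq_integrable => // w _ /=; congr EFin; rewrite /Z; ring.
have E m : \int[P]_w (Y w * X w) = \int[P]_w (Y w * (Z w - Q m w)).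
  transitivity (\int[P]_w (Y w * X w + b * Y w - Y w * Q m w)).
    rewrite (RintegralB measurableT (L1D iYX (L1Zl b iY)) (iYQ m)) YQ0 subr0.
    rewrite (RintegralD measurableT iYX (L1Zl b iY)).
    by rewrite (RintegralZl _ measurableT iY) YT mulr0 addr0.
  by apply: eq_Rintegral => w _; rewrite /Z; ring.
pose I := \int[P]_w `|Y w|.
have iY' : L1 (fun w => `|Y w|).
  by apply: (L1_dominated _ iY) => [|w]; [exact: measurableT_comp|rewrite normr_id].
have bound m : `|\int[P]_w (Y w * X w)| <= m.+1%:R^-1 * I.
  rewrite (E m); apply: le_trans (le_normr_Rintegral measurableT (iYZ m)) _.
  rewrite -(RintegralZl _ measurableT iY').
  apply: le_Rintegral => //; [|exact: L1Zl|].
    apply: (L1_dominated _ (iYZ m)) => [|w]; last by rewrite normr_id.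
    by apply: measurableT_comp => //; have /integrableP[/measurable_EFinP] := iYZ m.
  by move=> w _; rewrite normrM mulrC ler_wpM2r// grid_approx.
have I0 : 0 <= I by exact: Rintegral_ge0.
apply/eqP; rewrite -normr_le0; apply/ler_addgt0Pr => e e0; rewrite add0r.
(* With [m] the integer part of [I / e], the bound [m.+1%:R^-1 * I] is at most [e]. *)
apply: le_trans (bound (Num.trunc (I / e))) _.
rewrite mulrC ler_pdivrMr ?ltr0n// mulrC -ler_pdivrMr//.
by apply: ltW; have /andP[] := truncn_itv (divr_ge0 I0 (ltW e0)).
Qed.

End Filtration.

(** * Convergence of square-integrable martingales *)

Section MartingaleConvergence.
Variables (R : realType) (disp : measure_display) (Omega : measurableType disp).
Variable P : probability Omega R.
Variables (Fi : nat -> set (set Omega)) (D : nat -> Omega -> R) (c : nat -> R).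
Hypothesis Fi_sub : forall k, sub_sigma (Fi k).
Hypothesis Fi_mono : forall k, Fi k `<=` Fi k.+1.
Hypothesis D_adapted : forall k, fmeasurable (Fi k.+1) (D k).
Hypothesis D_L1 : forall k, L1 P (D k).
Hypothesis D_centered : forall k A, Fi k A -> \int[P]_(w in A) D k w = 0.
Hypothesis D_L2 : forall k, L1 P (fun w => D k w ^+ 2).
Hypothesis D_var : forall k, \int[P]_w (D k w ^+ 2) <= c k.
Hypothesis c_tail : forall e : R, 0 < e ->
  exists m, forall j, \sum_(m <= i < m + j) c i <= e.

(* The martingale restarted at time [m] and frozen once it leaves [(-e, e)]. *)
Fixpoint stopped (m : nat) (e : R) (j : nat) (w : Omega) : R :=
  if j is j'.+1 then
    stopped m e j' w + (if `|stopped m e j' w| < e then D (m + j') w else 0)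
  else 0.

Lemma stopped_fmeasurable m e j : fmeasurable (Fi (m + j)) (stopped m e j).
Proof.
elim: j => [|j IH].
  by apply/fmeasurableE; [exact: (Fi_sub _).1|exact: measurable_cst].
rewrite addnS; have sF := (Fi_sub (m + j).+1).1.
have mU : measurable_fun [set: g_sigma_algebraType (Fi (m + j).+1)]
    (stopped m e j : g_sigma_algebraType (Fi (m + j).+1) -> R).
  by apply/fmeasurableE => // B mB; apply: Fi_mono; exact: IH.
have mD : measurable_fun [set: g_sigma_algebraType (Fi (m + j).+1)]
    (D (m + j) : g_sigma_algebraType (Fi (m + j).+1) -> R).
  by apply/fmeasurableE => //; exact: D_adapted.
apply/fmeasurableE => //; apply: measurable_funD => //.
apply: measurable_fun_ifT => //; apply: measurable_fun_ltr => //.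
exact: measurableT_comp.
Qed.

Lemma stopped_measurable m e j : measurable_fun setT (stopped m e j).
Proof. exact: fmeasurable_measurable (Fi_sub _) (@stopped_fmeasurable m e j). Qed.

(** The increment is orthogonal to the past by [pull_out_bounded], so second moments add up without
    a cross term. *)
Lemma stopped_variance m e j : 0 < e -> L1 P (fun w => stopped m e j w ^+ 2) /\
  \int[P]_w (stopped m e j w ^+ 2) <= \sum_(m <= i < m + j) c i.
Proof.
move=> e0; elim: j => [|j [IH1 IH2]].
  rewrite addn0 big_geq//; split.
    by under eq_fun do rewrite expr0n/=; exact: L1_cst.
  by under eq_Rintegral do rewrite expr0n/=; rewrite Rintegral_cst// mul0r.
(* This is the past value as long as the process still moves; it is bounded by [e], as pulling it
   out requires. *)
pose X w := if `|stopped m e j w| < e then stopped m e j w else 0.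
have Xe w : `|X w| <= e by rewrite /X; case: ifP => [/ltW //|_]; rewrite normr0 ltW.
have FX : fmeasurable (Fi (m + j)) X.
  apply/fmeasurableE; first exact: (Fi_sub _).1.
  have mU := (fmeasurableE _ (Fi_sub (m + j)).1).1 (@stopped_fmeasurable m e j).
  apply: measurable_fun_ifT => //; apply: measurable_fun_ltr => //.
  exact: measurableT_comp.
have DX0 := pull_out_bounded (Fi_sub (m + j)) (D_L1 (m + j)) (@D_centered (m + j)) FX Xe.
have iDX : L1 P (fun w => D (m + j) w * X w).
  apply: (L1_dominated _ (L1Zl e (D_L1 (m + j)))) => [|w].
    apply: measurable_funM; last exact: fmeasurable_measurable (Fi_sub _) FX.
    exact: fmeasurable_measurable (Fi_sub _) (@D_adapted _).
  by rewrite !normrM mulrC ler_wpM2r// (ger0_norm (ltW e0)).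
pose S w := stopped m e j w ^+ 2 + 2 * (D (m + j) w * X w) + D (m + j) w ^+ 2.
have iS1 : L1 P (fun w => stopped m e j w ^+ 2 + 2 * (D (m + j) w * X w)).
  by apply: L1D => //; exact: L1Zl.
have iS : L1 P S by exact: L1D.
(* An equality while the process moves; after freezing, [S] has the extra square of [D]. *)
have US w : stopped m e j.+1 w ^+ 2 <= S w.
  rewrite /S /X /=; case: ifP => _; last by rewrite addr0 !mulr0 addr0 lerDl sqr_ge0.
  by rewrite le_eqVlt; apply/orP; left; apply/eqP; ring.
have iU : L1 P (fun w => stopped m e j.+1 w ^+ 2).
  apply: (L1_dominated _ iS) => [|w].
    by apply: measurable_funX; exact: stopped_measurable.
  by rewrite !ger0_norm ?sqr_ge0//; exact: le_trans (sqr_ge0 _) (US w).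
split=> //; apply: le_trans (le_Rintegral measurableT iU iS (fun w _ => US w)) _.
rewrite (RintegralD measurableT iS1 (D_L2 _)) (RintegralD measurableT IH1 (L1Zl 2 iDX)).
rewrite (RintegralZl _ measurableT iDX) DX0 mulr0 addr0 addnS big_nat_recr ?leq_addr//=.
exact: lerD.
Qed.

(** Chebyshev's inequality. A frozen process stays beyond [e], so the bound at time [j] controls all
    earlier times too and acts as a maximal inequality. *)
Lemma stopped_tail (m : nat) (e : R) (j : nat) : 0 < e ->
  (P [set w | (e <= `|stopped m e j w|)%R] <= ((\sum_(m <= i < m + j) c i)%R / e ^+ 2)%:E)%E.
Proof.
move=> e0; have [iU Uc] := @stopped_variance m e j e0.
set E := [set w | _].
have mE : measurable E.
  rewrite -[E]setTI; have := @stopped_measurable m e j => mU.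
  have mn : measurable_fun setT (fun w => `|stopped m e j w|) by exact: measurableT_comp.
  have := mn measurableT `[e, +oo[%classic; rewrite (_ : _ @^-1` _ = E); first by apply.
  by apply/seteqP; split => w; rewrite /E /= in_itv/= andbT.
have e2 : 0 < e ^+ 2 by rewrite exprn_gt0.
have iE : L1 P (\1_E : Omega -> R) by exact: integrable_indic.
have PE : fine (P E) * e ^+ 2 <= \sum_(m <= i < m + j) c i.
  apply: le_trans Uc; rewrite mulrC.
  have -> : fine (P E) = \int[P]_w (\1_E w) by rewrite /Rintegral integral_indic// setIT.
  rewrite -(RintegralZl _ measurableT iE).
  apply: le_Rintegral => //; first exact: L1Zl.
  move=> w _; rewrite indicE; case: (boolP (w \in E)) => wE /=; last by rewrite mulr0 sqr_ge0.
  rewrite mulr1; move: wE; rewrite inE /E /= => ew.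
  by rewrite -[leRHS]real_normK ?num_real// ler_sqr// nnegrE ltW.
by rewrite -[P E]fineK ?fin_num_measure// lee_fin ler_pdivlMr.
Qed.

Lemma stoppedE m e w : (forall j, `|stopped m e j w| < e) ->
  forall j, stopped m e j w = \sum_(m <= i < m + j) D i w.
Proof.
move=> He; elim=> [|j IH]; first by rewrite addn0 big_geq.
by rewrite /= He IH addnS big_nat_recr ?leq_addr.
Qed.

Lemma oscillation_negligible (e : R) : 0 < e ->
  P.-negligible [set w | forall m, exists j, e <= `|\sum_(m <= i < m + j) D i w|].
Proof.
move=> e0; pose E m j := [set w | e <= `|stopped m e j w|].
have mE m j : measurable (E m j).
  have mn : measurable_fun setT (fun w => `|stopped m e j w|).
    by apply: measurableT_comp => //; exact: stopped_measurable.
  rewrite -[E m j]setTI; have := mn measurableT `[e, +oo[%classic.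
  rewrite (_ : _ @^-1` _ = E m j); first by apply.
  by apply/seteqP; split => w; rewrite /E /= in_itv/= andbT.
have mU m : measurable (\bigcup_j E m j) by exact: bigcup_measurable.
have EU m (t : R) : (forall j, \sum_(m <= i < m + j) c i <= t) ->
    (P (\bigcup_j E m j) <= (t / e ^+ 2)%:E)%E.
  move=> ct; have : P (E m j) @[j --> \oo] --> P (\bigcup_j E m j).
    apply: nondecreasing_cvg_mu => //.
    apply/nondecreasing_seqP => j; rewrite subsetEset => w; rewrite /E /= => ew.
    by rewrite ltNge ew/= addr0.
  move=> /cvge_to_le; apply; apply: nearW => j.
  apply: le_trans (@stopped_tail m e j e0) _.
  by rewrite lee_fin ler_pM2r// invr_gt0 exprn_gt0.
exists (\bigcap_m \bigcup_j E m j); split.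
- exact: bigcap_measurable.
- apply/eqP; rewrite eq_le measure_ge0 andbT; apply/lee_addgt0Pr => r r0; rewrite add0e.
  have [|m cm] := c_tail (e := r * e ^+ 2); first by rewrite mulr_gt0// exprn_gt0.
  apply: (@le_trans _ _ (P (\bigcup_j E m j))).
    apply: le_measure; rewrite ?inE//; first exact: bigcap_measurable.
    exact: bigcap_inf.
  apply: le_trans (EU m _ cm) _.
  by rewrite mulfK// gt_eqF// exprn_gt0.
- move=> w /= He m _; have [j ej] := He m; apply: contrapT => nE.
  have lt k : `|stopped m e k w| < e.
    by rewrite ltNge; apply/negP => h; apply: nE; exists k.
  by move: ej; rewrite -(stoppedE lt) leNgt lt.
Qed.

(** Outside countably many negligible sets, one for each threshold [p.+1%:R^-1], the partial sums
    are Cauchy. *)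
Lemma L2_martingale_cvg :
  {ae P, forall w, cvg ((\sum_(0 <= j < k) D j w) @[k --> \oo])}.
Proof.
have : P.-negligible (\bigcup_(p : nat) [set w | forall m, exists j,
    (p.+1%:R^-1 : R) <= `|\sum_(m <= i < m + j) D i w|]).
  by apply: negligible_bigcup => p; apply: oscillation_negligible; rewrite invr_gt0.
apply: negligibleS => w; apply: contra_notP => H.
apply: cauchy_cvg; apply: cauchy_exP => e e0.
have [p pe] : exists p : nat, p.+1%:R^-1 < e.
  exists (Num.trunc e^-1); rewrite invf_plt ?posrE//.
  by have /andP[] := truncn_itv (ltW (divr_gt0 ltr01 e0)); rewrite div1r.
have [m Hm] : exists m, forall j, `|\sum_(m <= i < m + j) D i w| < p.+1%:R^-1.
  apply: contrapT => nm; apply: H; exists p => // m; apply: contrapT => nj.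
  by apply: nm; exists m => j; rewrite ltNge; apply/negP => h; apply: nj; exists j.
exists (\sum_(0 <= i < m) D i w); exists m => // k /= mk.
rewrite -ball_normE /= distrC (@big_cat_nat _ _ _ m 0 k)//= addrAC subrr add0r.
by rewrite -(subnKC mk) (lt_trans (Hm _)).
Qed.

End MartingaleConvergence.

Lemma series_unbounded (R : realType) (a : nat -> R) : (forall k, 0 <= a k) ->
  (\sum_(0 <= k <oo) (a k)%:E = +oo)%E ->
  forall M, exists m, M <= \sum_(0 <= j < m) a j.
Proof.
move=> a0 aoo M; apply: contrapT => H.
have : (\sum_(0 <= k <oo) (a k)%:E <= M%:E)%E.
  apply: lime_le; first by apply: is_cvg_nneseries => k _ _; rewrite lee_fin.
  apply: nearW => m; rewrite sumEFin lee_fin leNgt; apply/negP => Mm.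
  by apply: H; exists m; exact: ltW.
by rewrite aoo leye_eq.
Qed.

Lemma series_tail (R : realType) (a : nat -> R) : (forall k, 0 <= a k) ->
  (\sum_(0 <= k <oo) (a k)%:E < +oo)%E ->
  forall e, 0 < e -> exists m, forall j, \sum_(m <= i < m + j) a i <= e.
Proof.
move=> a0 alty e e0; set s := (\sum_(0 <= k <oo) (a k)%:E)%E in alty.
have s0 : (0 <= s)%E by apply: nneseries_ge0 => k _ _; rewrite lee_fin.
have sfin : s \is a fin_num by rewrite ge0_fin_numE.
have partial m : \sum_(0 <= i < m) a i <= fine s.
  rewrite -lee_fin fineK// -sumEFin; apply: nneseries_lim_ge => k _ _.
  by rewrite lee_fin.
have [m Hm] : exists m, fine s - e < \sum_(0 <= i < m) a i.
  apply: contrapT => H; have : (s <= (fine s - e)%:E)%E.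
    apply: lime_le; first by apply: is_cvg_nneseries => k _ _; rewrite lee_fin.
    apply: nearW => m; rewrite sumEFin lee_fin leNgt; apply/negP => Mm.
    by apply: H; exists m.
  by rewrite -(fineK sfin) lee_fin lerBrDl gerDr leNgt e0.
exists m => j; have := partial (m + j)%N.
rewrite (@big_cat_nat _ _ _ m)//= ?leq_addr//; lra.
Qed.

(** * Noise scaled by square-summable steps *)

Section Noise.
Variables (R : realType) (disp : measure_display) (Omega : measurableType disp).
Variable P : probability Omega R.
Implicit Type F : set (set Omega).

Lemma Rintegral_probability_cst (C : R) : \int[P]_w C = C.
Proof.
rewrite Rintegral_cst//; have /(congr1 fine) -> := @probability_setT _ _ _ P.
by rewrite mulr1.
Qed.

Lemma sub_sigma_sigma_of (d : nat) (XS : set (Omega -> 'rV[R]_d)) :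
  (forall X, XS X -> random_vector X) -> sub_sigma (sigma_of XS).
Proof.
move=> rX; split; first exact: smallest_sigma_algebra.
apply: smallest_sub; first exact: sigma_algebra_measurable.
move=> _ [X [i [B [XX mB ->]]]].
by have := rX X XX i measurableT B mB; rewrite setTI.
Qed.

Lemma sigma_of_fmeasurable (d : nat) (XS : set (Omega -> 'rV[R]_d)) X i :
  XS X -> fmeasurable (sigma_of XS) (fun w => X w ord0 i).
Proof. by move=> XX B mB; apply: sub_gen_smallest; exists X, i, B. Qed.

Lemma fmeasurable_enorm (d : nat) F (X : Omega -> 'rV[R]_d) : sub_sigma F ->
  (forall i, fmeasurable F (fun w => X w ord0 i)) -> fmeasurable F (fun w => enorm (X w)).
Proof.
move=> [sF _] FX; apply/fmeasurableE => //.
rewrite /enorm; apply: measurableT_comp.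
  by apply: continuous_measurable_fun; exact: sqrt_continuous.
apply: measurable_sum => i; apply: measurable_funX.
by have /fmeasurableE := FX i; exact.
Qed.

Lemma fmeasurableD F (X Y : Omega -> R) : sub_sigma F ->
  fmeasurable F X -> fmeasurable F Y -> fmeasurable F (fun w => X w + Y w).
Proof.
by move=> [sF _] /(fmeasurableE _ sF) mX /(fmeasurableE _ sF) mY;
  apply/fmeasurableE => //; exact: measurable_funD.
Qed.

Lemma fmeasurableM F (X Y : Omega -> R) : sub_sigma F ->
  fmeasurable F X -> fmeasurable F Y -> fmeasurable F (fun w => X w * Y w).
Proof.
by move=> [sF _] /(fmeasurableE _ sF) mX /(fmeasurableE _ sF) mY;
  apply/fmeasurableE => //; exact: measurable_funM.
Qed.

Lemma fmeasurable_cst F (c : R) : sub_sigma F -> fmeasurable F (cst c).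
Proof. by move=> [sF _]; apply/fmeasurableE => //; exact: measurable_cst. Qed.

(** A conditional mean satisfies the subgradient bound only almost surely; truncation makes it
    bounded everywhere and changes it on a null set only. *)
Definition clip (K x : R) := Num.max (- K) (Num.min K x).

Lemma clip_norm K x : 0 <= K -> `|clip K x| <= K.
Proof.
by move=> K0; rewrite /clip ler_norml le_max lexx/= ge_max ge_min lexx andbT; lra.
Qed.

Lemma clip_id K x : `|x| <= K -> clip K x = x.
Proof. by rewrite ler_norml => /andP[x1 x2]; rewrite /clip min_r// max_r. Qed.

Lemma fmeasurable_clip F K (X : Omega -> R) : sub_sigma F ->
  fmeasurable F X -> fmeasurable F (fun w => clip K (X w)).
Proof.
move=> [sF _] /(fmeasurableE _ sF) mX; apply/fmeasurableE => //.
by apply: measurable_maxr => //; exact: measurable_minr.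
Qed.

Lemma cond_exp_Rintegral F (X Y : Omega -> R) A : is_cond_exp P F X Y -> F A ->
  \int[P]_(w in A) Y w = \int[P]_(w in A) X w.
Proof. by move=> [_ _ _ H] /H; rewrite /Rintegral => ->. Qed.

Lemma L1_bounded (X : Omega -> R) (C : R) : measurable_fun setT X ->
  (forall w, `|X w| <= C) -> L1 P X.
Proof.
move=> mX XC; apply: (L1_dominated mX (L1_cst P C)) => w /=.
exact: le_trans (XC w) (ler_norm _).
Qed.

Lemma scaled_noise_cvg (Fi : nat -> set (set Omega)) (alpha : nat -> R)
    (X : nat -> Omega -> R) (C : R) :
  (forall k, sub_sigma (Fi k)) -> (forall k, Fi k `<=` Fi k.+1) ->
  (forall k, fmeasurable (Fi k.+1) (X k)) -> (forall k, L1 P (X k)) ->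
  (forall k A, Fi k A -> \int[P]_(w in A) X k w = 0) ->
  (forall k, L1 P (fun w => X k w ^+ 2)) ->
  (forall k, \int[P]_w (X k w ^+ 2) <= C) ->
  (\sum_(0 <= k <oo) ((alpha k) ^+ 2)%:E < +oo)%E ->
  {ae P, forall w, cvg ((\sum_(0 <= j < k) alpha j * X j w) @[k --> \oo])}.
Proof.
move=> sF mF FX iX X0 iX2 XC asum.
have C0 : 0 <= C by apply: le_trans (XC 0%N); apply: Rintegral_ge0 => w _; exact: sqr_ge0.
apply: (@L2_martingale_cvg _ _ _ P Fi (fun j w => alpha j * X j w)
  (fun k => alpha k ^+ 2 * C)) => //.
- by move=> k; apply: fmeasurableM => //; exact: fmeasurable_cst.
- by move=> k; exact: L1Zl.
- move=> k A FA; have mA := (sF k).2 _ FA; rewrite RintegralZl//; first by rewrite X0// mulr0.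
  exact: integrableS (iX k).
- by move=> k; under eq_fun do rewrite exprMn; exact: L1Zl.
- move=> k; under eq_Rintegral do rewrite exprMn.
  by rewrite (RintegralZl _ measurableT (iX2 k)) ler_wpM2l ?sqr_ge0.
(* [C] may be 0, so the tail of the squared steps is compared with [e / (C + 1)]. *)
move=> e e0; have C1 : 0 < C + 1 by rewrite ltr_wpDl.
have [m Hm] := series_tail (fun k => sqr_ge0 (alpha k)) asum (divr_gt0 e0 C1).
exists m => j; rewrite -mulr_suml.
have := Hm j; rewrite ler_pdivlMr// => h; apply: le_trans h.
by rewrite ler_wpM2l ?lerDl// sumr_ge0// => i _; exact: sqr_ge0.
Qed.

End Noise.

(** * Almost sure convergence of the stochastic iteration *)

Theorem theorem4 (R : realType) (n : nat) (D : placement R n.+1)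
  (L B : R) (hL0 : 0 < L) (hB0 : 0 < B)
  (hL : forall z v, clarke (f0 D) z v -> enorm v <= L)
  (hB : forall z s, clarke (fb D) z s -> enorm s <= B)
  (disp : measure_display) (Omega : measurableType disp)
  (P : probability Omega R)
  (alpha eps : nat -> R) (sigma : R)
  (z v s g xi eta : nat -> Omega -> 'rV[R]_(n.+1 * 2))
  (* initial point and estimator *)
  (hz0 : random_vector (z 0%N))
  (hz0_bounded : exists M : R, forall w, enorm (z 0%N w) <= M)
  (hg_rv : forall k, random_vector (g k))
  (* iteration *)
  (hv : forall k w, clarke (f0 D) (z k w) (v k w))
  (hs : forall k w, clarke (fb D) (z k w) (s k w))
  (hg : forall k w, g k w = v k w + s k w)
  (hxi : forall k w, xi k w = (eps k * enorm (g k w)) *: eta k w)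
  (hz : forall k w, z k.+1 w = z k w - alpha k *: (g k w + xi k w))
  (* perturbations *)
  (heps0 : 0 <= eps 0%N)
  (heps : forall k, (0 < k)%N -> eps k = 2 / 10 / k%:R ^+ 3)
  (heta_law : forall k, standard_gaussian P (eta k))
  (heta_indep : forall k,
     independent_sigma P (sigma_of [set eta k])
       (sigma_of (history z g eta k `|` [set g k])))
  (* conditional moments *)
  (hunbiased : forall k, exists2 Y : Omega -> 'rV[R]_(n.+1 * 2),
     is_vcond_exp P (sigma_of (history z g eta k)) (g k) Y &
     {ae P, forall w, clarke (objective D) (z k w) (Y w)})
  (hxi_mean : forall k, exists2 Y : Omega -> 'rV[R]_(n.+1 * 2),
     is_vcond_exp P (sigma_of (history z g eta k)) (xi k) Y &
     {ae P, forall w, Y w = 0})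
  (hxi_var : forall k, exists2 Y : Omega -> R,
     is_cond_exp P (sigma_of (history z g eta k))
       (fun w => enorm (xi k w) ^+ 2) Y &
     {ae P, forall w, Y w <= sigma ^+ 2})
  (* penalty and stepsizes *)
  (hmu : L < min_bnd_pen D)
  (halpha_gt0 : forall k, 0 < alpha k)
  (halpha_lim : alpha k @[k --> \oo] --> (0 : R))
  (halpha_sum : (\sum_(0 <= k <oo) (alpha k)%:E = +oo)%E)
  (halpha_sqr : (\sum_(0 <= k <oo) ((alpha k) ^+ 2)%:E < +oo)%E) :
  {ae P, forall w,
     edist_to (z k w) [set y | clarke (objective D) y 0] @[k --> \oo] --> 0%E}.
Proof.
pose F k := sigma_of (history z g eta k).
have rX k X : history z g eta k X -> random_vector X.
  by move=> [->//|[j _ [->//|->]]]; have [] := heta_law j.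
have sF k : sub_sigma (F k) by exact: sub_sigma_sigma_of (rX k).
have mF k : F k `<=` F k.+1.
  rewrite /F /sigma_of; apply: smallest_sub; first exact: smallest_sigma_algebra.
  move=> _ [X [i [C [XX mC ->]]]]; apply: sub_gen_smallest; exists X, i, C; split=> //.
  by case: XX => [->|[j jk Xj]]; [left|right; exists j => //; exact: ltnW].
have Fg k i : fmeasurable (F k.+1) (fun w => g k w ord0 i).
  by apply: sigma_of_fmeasurable; right; exists k => //; left.
have Feta k i : fmeasurable (F k.+1) (fun w => eta k w ord0 i).
  by apply: sigma_of_fmeasurable; right; exists k => //; right.
have Fxi k i : fmeasurable (F k.+1) (fun w => xi k w ord0 i).
  rewrite (_ : (fun w => _) = fun w => eps k * enorm (g k w) * eta k w ord0 i); last first.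
    by apply/funext => w; rewrite hxi mxE.
  apply: (fmeasurableM (sF k.+1) _ (Feta k i)).
  apply: (fmeasurableM (sF k.+1) (fmeasurable_cst (eps k) (sF k.+1))).
  exact: fmeasurable_enorm (sF k.+1) (Fg k).
have gLB k w i : `|g k w ord0 i| <= L + B.
  rewrite hg mxE (le_trans (ler_normD _ _))//; apply: lerD.
    exact: le_trans (coord_le_enorm _ _) (hL _ _ (hv k w)).
  exact: le_trans (coord_le_enorm _ _) (hB _ _ (hs k w)).
have xicvg i : {ae P, forall w,
    cvg ((\sum_(0 <= j < k) alpha j * xi j w ord0 i) @[k --> \oo])}.
  have xi2 k : L1 P (fun w => xi k w ord0 i ^+ 2) /\
      \int[P]_w (xi k w ord0 i ^+ 2) <= sigma ^+ 2.
    have [Y [iE iY mY YE] Ysig] := hxi_var k.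
    have mxi : measurable_fun setT (fun w => xi k w ord0 i).
      exact: fmeasurable_measurable (sF _) (Fxi k i).
    have le w : xi k w ord0 i ^+ 2 <= enorm (xi k w) ^+ 2.
      rewrite -[leLHS]real_normK ?num_real// ler_sqr ?nnegrE ?sqrtr_ge0//.
      exact: coord_le_enorm.
    have ixi2 : L1 P (fun w => xi k w ord0 i ^+ 2).
      apply: (L1_dominated _ iE) => [|w]; first exact: measurable_funX.
      by rewrite !ger0_norm ?sqr_ge0.
    split=> //; apply: le_trans (le_Rintegral measurableT ixi2 iE (fun w _ => le w)) _.
    have FT : F k setT by rewrite -(preimage_setT Y); exact: mY.
    rewrite -(cond_exp_Rintegral (And4 iE iY mY YE) FT).
    (* The conditional second moment is at most [sigma ^+ 2] only almost surely; the minimum obeys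
       the bound everywhere and has the same integral. *)
    pose Y' w := Num.min (Y w) (sigma ^+ 2).
    have mYm : measurable_fun setT Y by have /integrableP[/measurable_EFinP] := iY.
    have mY' : measurable_fun setT Y' by exact: measurable_minr.
    have YY' : \int[P]_w Y w = \int[P]_w Y' w.
      congr fine; apply: ae_eq_integral => //; try exact/measurable_EFinP.
      by apply: filterS Ysig => w Yw _; rewrite /Y' min_l.
    have iY' : L1 P Y'.
      have iYn : L1 P (fun w => `|Y w|) by exact: integrable_norm iY.
      apply: (L1_dominated mY' (L1D iYn (L1_cst P (sigma ^+ 2)))) => w.
      have s0 : 0 <= sigma ^+ 2 by exact: sqr_ge0.
      rewrite [leRHS]ger0_norm ?addr_ge0// /Y' minEle /=.
      by case: ifP => _; rewrite ?lerDl// ger0_norm// lerDr.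
    rewrite YY'; apply: le_trans (_ : \int[P]_w (sigma ^+ 2) <= _).
      by apply: le_Rintegral => //; [exact: L1_cst|move=> w _; rewrite ge_min lexx orbT].
    by rewrite Rintegral_probability_cst.
  apply: (@scaled_noise_cvg _ _ _ P F alpha _ (sigma ^+ 2)) => //.
  - by move=> k; have [Y /(_ i)[]] := hxi_mean k.
  - move=> k A FA; have [Y YE Y0] := hxi_mean k.
    rewrite -(cond_exp_Rintegral (YE i) FA).
    have mA := (sF k).2 _ FA; have [_ iY _ _] := YE i.
    rewrite /Rintegral (@ae_eq_integral _ _ _ P A (cst 0%E)) ?integral0//.
      by apply: (measurable_funS measurableT) => //; have /integrableP[] := iY.
    by apply: filterS Y0 => w -> _; rewrite /= mxE.
  - by move=> k; have [] := xi2 k.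
  - by move=> k; have [] := xi2 k.
have /choice[Y HY] : forall k, exists Y : Omega -> 'rV[R]_(n.+1 * 2),
    is_vcond_exp P (F k) (g k) Y /\ {ae P, forall w, clarke (objective D) (z k w) (Y w)}.
  by move=> k; have [Y Y1 Y2] := hunbiased k; exists Y.
have [[K K0 fK] _ _] := pwl_objective D.
have YK k w i : clarke (objective D) (z k w) (Y k w) -> clip K (Y k w ord0 i) = Y k w ord0 i.
  by move=> cY; apply: clip_id; exact: (clarke_bound (ltW K0) fK cY).
(* The estimator minus its clipped conditional mean is a bounded martingale difference. *)
have mcvg i : {ae P, forall w,
    cvg ((\sum_(0 <= j < k) alpha j * (g j w ord0 i - clip K (Y j w ord0 i))) @[k --> \oo])}.
  have Fclip k : fmeasurable (F k) (fun w => clip K (Y k w ord0 i)).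
    by apply: fmeasurable_clip => //; have [/(_ i)[]] := HY k.
  have FX k : fmeasurable (F k.+1) (fun w => g k w ord0 i - clip K (Y k w ord0 i)).
    rewrite (_ : (fun w => _) = fun w => g k w ord0 i + -1 * clip K (Y k w ord0 i)).
      apply: (fmeasurableD (sF k.+1) (Fg k i)).
      apply: (fmeasurableM (sF k.+1) (fmeasurable_cst (-1) (sF k.+1))).
      by move=> C mC; apply: mF; exact: Fclip.
    by apply/funext => w; rewrite mulN1r.
  have mX k : measurable_fun setT (fun w => g k w ord0 i - clip K (Y k w ord0 i)).
    exact: fmeasurable_measurable (sF _) (FX k).
  have Xb k w : `|g k w ord0 i - clip K (Y k w ord0 i)| <= L + B + K.
    by rewrite (le_trans (ler_normB _ _))// lerD ?gLB// clip_norm// ltW.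
  have X2b k w : (g k w ord0 i - clip K (Y k w ord0 i)) ^+ 2 <= (L + B + K) ^+ 2.
    rewrite -[leLHS]real_normK ?num_real// ler_sqr ?nnegrE// !addr_ge0// ltW//.
  have iX2 k : L1 P (fun w => (g k w ord0 i - clip K (Y k w ord0 i)) ^+ 2).
    apply: (@L1_bounded _ _ _ _ _ ((L + B + K) ^+ 2)); first exact: measurable_funX.
    by move=> w; rewrite ger0_norm ?sqr_ge0.
  apply: (@scaled_noise_cvg _ _ _ P F alpha _ ((L + B + K) ^+ 2)) => //.
  - by move=> k; exact: L1_bounded (mX k) (Xb k).
  - move=> k A FA; have mA := (sF k).2 _ FA.
    have [YE cY] := HY k; have [ig iY _ _] := YE i.
    have mclip : measurable_fun setT (fun w => clip K (Y k w ord0 i)).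
      exact: fmeasurable_measurable (sF _) (Fclip k).
    have iclip : L1 P (fun w => clip K (Y k w ord0 i)).
      by apply: (@L1_bounded _ _ _ P _ K mclip) => w; exact: (clip_norm _ (ltW K0)).
    rewrite RintegralB//; [|exact: integrableS ig|exact: integrableS iclip].
    (* Almost surely [Y k] is a subgradient and clipping leaves it unchanged, so the clipped
       integral over [A] is that of [g k]. *)
    rewrite -(cond_exp_Rintegral (YE i) FA) (_ : \int[P]_(w in A) clip _ _ =
      \int[P]_(w in A) (Y k w ord0 i)) ?subrr//.
    congr fine; apply: ae_eq_integral => //.
    + by apply/measurable_EFinP; exact: measurable_funS mclip.
    + by apply: (measurable_funS measurableT) => //; have /integrableP[] := iY.
    + by apply: filterS cY => w cYw _; rewrite YK.
  - move=> k; apply: (@le_trans _ _ (\int[P]_w ((L + B + K) ^+ 2))).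
      by apply: le_Rintegral => //; [exact: iX2|exact: L1_cst].
    by rewrite Rintegral_probability_cst.
have aeY : {ae P, forall w, forall k, clarke (objective D) (z k w) (Y k w)}.
  by apply: ae_foralln => k; have [] := HY k.
have aexi : {ae P, forall w, forall i,
    cvg ((\sum_(0 <= j < k) alpha j * xi j w ord0 i) @[k --> \oo])}.
  exact: filter_forall.
have aem : {ae P, forall w, forall i,
    cvg ((\sum_(0 <= j < k) alpha j * (g j w ord0 i - clip K (Y j w ord0 i))) @[k --> \oo])}.
  exact: filter_forall.
(* From here on the sample [w] is fixed, outside three null sets; on it every [Y k w] is a
   subgradient and clipping is the identity. *)
apply: filterS3 aeY aexi aem => w cY xic mc.
apply: (@placement_dist_cvg0 _ _ D L B alpha (z^~ w) (v^~ w) (s^~ w) (xi^~ w) (Y^~ w)) => //.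
- exact: series_unbounded (fun k => ltW (halpha_gt0 k)) halpha_sum.
- by move=> k; rewrite hz hg.
- move=> i; rewrite [X in cvg (X @ _)](_ : _ = fun k =>
    \sum_(0 <= j < k) alpha j * (g j w ord0 i - clip K (Y j w ord0 i))); first exact: mc.
  by apply/funext => k; apply: eq_bigr => j _; rewrite YK// hg !mxE.
Qed.
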